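(* Let $(\Omega,\Sigma,\mu)$ be a complete finite measure space, let $(\mathcal H,L)$ be a measurable bundle of complex Hilbert spaces over $\Omega$, and let $T:L^0(\Omega,\mathcal H)\to L^0(\Omega,\mathcal H)$ be a contraction. Then there is a projection $\hat P$ in $L^0(\Omega,\mathcal H)$ such that, for all $\hat u\in L^0(\Omega,\mathcal H)$, $$A_n(T,\hat u)=\frac1n\sum_{k=0}^{n-1}T^k\hat u\ \longrightarrow\ \hat P(\hat u)\quad\text{in }L^0(\Omega,\mathcal H)\text{ as }n\to\infty .$$
   Context: $L^0=L^0(\Omega)$ is the algebra of a.e.-equivalence classes of complex measurable functions on $\Omega$; order relations between real elements of $L^0$ are a.e., and $\mathbf 1\in L^0$ is the class of the constant function $1$. Measurable bundle of Hilbert spaces: $\mathcal H$ assigns to each $\omega\in\Omega$ a complex Hilbert space $\mathcal H(\omega)$. A section is a function $u$ defined a.e. on $\Omega$, with domain $\mathrm{dom}(u)$, such that $u(\omega)\in\mathcal H(\omega)$ for $\omega\in\mathrm{dom}(u)$. For a set $L$ of sections, $(\mathcal H,L)$ is a measurable bundle if (1) $\lambda_1c_1+\lambda_2c_2\in L$ for all $\lambda_1,\lambda_2\in\mathbb C$, $c_1,c_2\in L$, where this section is defined pointwise on $\mathrm{dom}(c_1)\cap\mathrm{dom}(c_2)$; (2) $\omega\mapsto\|c(\omega)\|_{\mathcal H(\omega)}$ is measurable for all $c\in L$; (3) for every $\omega\in\Omega$ the set $\{c(\omega):c\in L,\ \omega\in\mathrm{dom}(c)\}$ is dense in $\mathcal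 H(\omega)$. A step-section is $s(\omega)=\sum_{i=1}^n\chi_{A_i}(\omega)c_i(\omega)$ with $c_i\in L$, $A_i\in\Sigma$. A section $u$ is measurable if there are step-sections $s_n$ with $\|s_n(\omega)-u(\omega)\|_{\mathcal H(\omega)}\to0$ for almost all $\omega$. $M(\Omega,\mathcal H)$ is the set of measurable sections, and $L^0(\Omega,\mathcal H)$ is its quotient by a.e. equality; $\hat u$ is the class of $u$. $L^0(\Omega,\mathcal H)$ is an $L^0$-module under pointwise operations, with $L^0$-valued inner product $\langle\hat u,\hat v\rangle$ = the class of $\omega\mapsto(u(\omega),v(\omega))_{\mathcal H(\omega)}$ and $L^0$-valued norm $\|\hat u\|=\sqrt{\langle\hat u,\hat u\rangle}$; it is a Hilbert–Kaplansky space over $L^0$ (and every Hilbert–Kaplansky space over $L^0$ is isometrically isomorphic to one of this form). An operator $T:L^0(\Omega,\mathcal H)\to L^0(\Omega,\mathcal H)$ is $L^0$-linear if $T(\alpha x+\beta y)=\alpha T(x)+\beta T(y)$ for all $\alpha,\beta\in L^0$ and all $x,y$; an $L^0$-linear $T$ is $L^0$-bounded if it maps bounded sets (sets $B$ with $\{\|x\|:x\in B\}$ order bounded in $L^0$) to bounded sets. Its norm is $\|T\|=\sup\{\|Tx\|:\|x\|\le\mathbf 1\}\in L^0$. A contraction in $L^0(\Omega,\mathcal H)$ is an $L^0$-linear, $L^0$-bounded operator with $\|T\|\le\mathbf 1$. A projection in $L^0(\Omega,\mathcal H)$ is an $L^0$-linear, $L^0$-bounded operator $\hat P$ with $\hat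 P^2=\hat P$ and $\hat P^*=\hat P$, i.e. $\langle\hat Px,y\rangle=\langle x,\hat Py\rangle$ for all $x,y$. Convergence of a sequence $x_n\to x$ in $L^0(\Omega,\mathcal H)$ means $(bo)$-convergence: $\|x_n-x\|$ order converges to $0$ in $L^0$, equivalently $\|x_n(\omega)-x(\omega)\|_{\mathcal H(\omega)}\to0$ for almost all $\omega$. *)

(* Defs.v *)
From HB Require Import structures.
From mathcomp Require Import all_boot all_order all_algebra.
From mathcomp Require Import all_classical all_reals all_analysis.
From mathcomp Require Import measurable_realfun.
From mathcomp Require Import ring lra complex.

Set Implicit Arguments.
Unset Strict Implicit.
Unset Printing Implicit Defensive.

Import Order.TTheory GRing.Theory Num.Theory.
Import numFieldNormedType.Exports.

Local Open Scope classical_set_scope.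
Local Open Scope ring_scope.
Local Open Scope quotient_scope.

Section ae_lemmas.
Context d (T : measurableType d) (R : realType).
Variable mu : {measure set T -> \bar R}.

Lemma ae_imp1 (P Q : T -> Prop) : (forall w, P w -> Q w) ->
  {ae mu, forall w, P w} -> {ae mu, forall w, Q w}.
Proof. by move=> PQ; apply: filterS. Qed.

Lemma ae_imp2 (P Q S : T -> Prop) : (forall w, P w -> Q w -> S w) ->
  {ae mu, forall w, P w} -> {ae mu, forall w, Q w} -> {ae mu, forall w, S w}.
Proof. by move=> PQS; apply: filterS2. Qed.

Lemma ae_imp3 (P Q S U : T -> Prop) : (forall w, P w -> Q w -> S w -> U w) ->
  {ae mu, forall w, P w} -> {ae mu, forall w, Q w} ->
  {ae mu, forall w, S w} -> {ae mu, forall w, U w}.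
Proof. by move=> PQSU; apply: filterS3. Qed.

End ae_lemmas.

Section cmeasurable.
Context d (T : measurableType d) (R : realType).
Implicit Types f g : T -> R[i].

Definition cmeasurable f : Prop :=
  measurable_fun setT (fun w => complex.Re (f w)) /\
  measurable_fun setT (fun w => complex.Im (f w)).

Lemma cReD (x y : R[i]) : complex.Re (x + y) = complex.Re x + complex.Re y.
Proof. by case: x y => [a b] [c e]. Qed.

Lemma cImD (x y : R[i]) : complex.Im (x + y) = complex.Im x + complex.Im y.
Proof. by case: x y => [a b] [c e]. Qed.

Lemma cReM (x y : R[i]) : complex.Re (x * y) =
  complex.Re x * complex.Re y - complex.Im x * complex.Im y.
Proof. by case: x y => [a b] [c e]. Qed.

Lemma cImM (x y : R[i]) : complex.Im (x * y) =
  complex.Re x * complex.Im y + complex.Im x * complex.Re y.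
Proof. by case: x y => [a b] [c e]. Qed.

Lemma cmeasurable_cst (a : R[i]) : cmeasurable (fun=> a).
Proof. by split; exact: measurable_cst. Qed.

Lemma cmeasurableD f g :
  cmeasurable f -> cmeasurable g -> cmeasurable (fun w => f w + g w).
Proof.
move=> [f1 f2] [g1 g2]; split.
- by under eq_fun do rewrite cReD; exact: measurable_funD.
- by under eq_fun do rewrite cImD; exact: measurable_funD.
Qed.

Lemma cmeasurableM f g :
  cmeasurable f -> cmeasurable g -> cmeasurable (fun w => f w * g w).
Proof.
move=> [f1 f2] [g1 g2]; split.
- by under eq_fun do rewrite cReM; apply: measurable_funB; exact: measurable_funM.
- by under eq_fun do rewrite cImM; apply: measurable_funD; exact: measurable_funM.
Qed.

Lemma cmeasurableN f : cmeasurable f -> cmeasurable (fun w => - f w).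
Proof.
move=> mf; have := cmeasurableM (cmeasurable_cst (-1 : R[i])) mf.
by under eq_fun do rewrite mulN1r.
Qed.

End cmeasurable.

Record cmfun d (T : measurableType d) (R : realType) := CMfun {
  cmfun_fun :> T -> R[i] ;
  cmfunP : cmeasurable cmfun_fun }.

HB.instance Definition _ d (T : measurableType d) (R : realType) :=
  gen_eqMixin (cmfun T R).
HB.instance Definition _ d (T : measurableType d) (R : realType) :=
  gen_choiceMixin (cmfun T R).

Section L0.
Context d (T : measurableType d) (R : realType).
Variable mu : {measure set T -> \bar R}.

Definition L0_eqv (f g : cmfun T R) : bool :=
  `[< {ae mu, forall w, f w = g w} >].

Let L0_eqv_refl : reflexive L0_eqv.
Proof. by move=> f; apply/asboolP; exact: aeW. Qed.

Let L0_eqv_sym : symmetric L0_eqv.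
Proof. by move=> f g; apply/asboolP/asboolP; apply: ae_imp1 => w ->. Qed.

Let L0_eqv_trans : transitive L0_eqv.
Proof.
by move=> f g h /asboolP gf /asboolP fh; apply/asboolP;
  apply: ae_imp2 gf fh => w -> ->.
Qed.

Canonical L0_equiv := EquivRel L0_eqv L0_eqv_refl L0_eqv_sym L0_eqv_trans.

Definition L0 : Type := {eq_quot L0_eqv}.
HB.instance Definition _ := Choice.on L0.
HB.instance Definition _ := EqQuotient.on L0.

Definition L0_class f (mf : cmeasurable f) : L0 := \pi_L0 (CMfun mf).

Lemma L0P (x y : L0) : {ae mu, forall w, repr x w = repr y w} <-> x = y.
Proof.
split=> [xy|->]; last exact: aeW.
by rewrite -(reprK x) -(reprK y); apply/eqmodP/asboolP.
Qed.

Lemma L0_classE f (mf : cmeasurable f) :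
  {ae mu, forall w, repr (L0_class mf) w = f w}.
Proof.
have /eqmodP/asboolP : repr (L0_class mf) = CMfun mf %[mod L0] by rewrite reprK.
by [].
Qed.

Definition L0_cst (a : R[i]) : L0 := L0_class (cmeasurable_cst T a).
Definition L0_add (x y : L0) : L0 :=
  L0_class (cmeasurableD (cmfunP (repr x)) (cmfunP (repr y))).
Definition L0_mul (x y : L0) : L0 :=
  L0_class (cmeasurableM (cmfunP (repr x)) (cmfunP (repr y))).
Definition L0_opp (x : L0) : L0 := L0_class (cmeasurableN (cmfunP (repr x))).

Let addE x y : {ae mu, forall w, repr (L0_add x y) w = repr x w + repr y w}.
Proof. exact: L0_classE. Qed.
Let mulE x y : {ae mu, forall w, repr (L0_mul x y) w = repr x w * repr y w}.
Proof. exact: L0_classE. Qed.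
Let oppE x : {ae mu, forall w, repr (L0_opp x) w = - repr x w}.
Proof. exact: L0_classE. Qed.
Let cstE a : {ae mu, forall w, repr (L0_cst a) w = a}.
Proof. exact: L0_classE. Qed.



Let addA : associative L0_add.
Proof.
move=> x y z; apply/L0P; near=> w.
rewrite (near (addE x (L0_add y z)) w) // (near (addE y z) w) //.
rewrite (near (addE (L0_add x y) z) w) // (near (addE x y) w) //.
by rewrite addrA.
Unshelve. all: by end_near. Qed.

Let addC : commutative L0_add.
Proof.
move=> x y; apply/L0P; near=> w.
by rewrite (near (addE x y) w) // (near (addE y x) w) // addrC.
Unshelve. all: by end_near. Qed.

Let add0 : left_id (L0_cst 0) L0_add.
Proof.
move=> x; apply/L0P; near=> w.
by rewrite (near (addE (L0_cst 0) x) w) // (near (cstE 0) w) // add0r.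
Unshelve. all: by end_near. Qed.

Let addN : left_inverse (L0_cst 0) L0_opp L0_add.
Proof.
move=> x; apply/L0P; near=> w.
rewrite (near (addE (L0_opp x) x) w) // (near (oppE x) w) //.
by rewrite (near (cstE 0) w) // addNr.
Unshelve. all: by end_near. Qed.

HB.instance Definition _ := GRing.isZmodule.Build L0 addA addC add0 addN.

Let mulA : associative L0_mul.
Proof.
move=> x y z; apply/L0P; near=> w.
rewrite (near (mulE x (L0_mul y z)) w) // (near (mulE y z) w) //.
rewrite (near (mulE (L0_mul x y) z) w) // (near (mulE x y) w) //.
by rewrite mulrA.
Unshelve. all: by end_near. Qed.

Let mulC : commutative L0_mul.
Proof.
move=> x y; apply/L0P; near=> w.
by rewrite (near (mulE x y) w) // (near (mulE y x) w) // mulrC.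
Unshelve. all: by end_near. Qed.

Let mul1 : left_id (L0_cst 1) L0_mul.
Proof.
move=> x; apply/L0P; near=> w.
by rewrite (near (mulE (L0_cst 1) x) w) // (near (cstE 1) w) // mul1r.
Unshelve. all: by end_near. Qed.

Let mulD : left_distributive L0_mul L0_add.
Proof.
move=> x y z; apply/L0P; near=> w.
rewrite (near (mulE (L0_add x y) z) w) // (near (addE x y) w) //.
rewrite (near (addE (L0_mul x z) (L0_mul y z)) w) //.
by rewrite (near (mulE x z) w) // (near (mulE y z) w) // mulrDl.
Unshelve. all: by end_near. Qed.

(* [L0 mu] is the zero ring when [mu = 0], hence [comPzRingType] *)
HB.instance Definition _ :=
  GRing.Zmodule_isComPzRing.Build L0 mulA mulC mul1 mulD.

Lemma L0_cstE a : {ae mu, forall w, repr (L0_cst a) w = a}.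
Proof. exact: cstE. Qed.

Lemma L0_0E : {ae mu, forall w, repr (0 : L0) w = 0}.
Proof. exact: cstE. Qed.

Lemma L0_1E : {ae mu, forall w, repr (1 : L0) w = 1}.
Proof. exact: cstE. Qed.

Lemma L0_addE (x y : L0) :
  {ae mu, forall w, repr (x + y) w = repr x w + repr y w}.
Proof. exact: addE. Qed.

Lemma L0_mulE (x y : L0) :
  {ae mu, forall w, repr (x * y) w = repr x w * repr y w}.
Proof. exact: mulE. Qed.

Lemma L0_oppE (x : L0) : {ae mu, forall w, repr (- x) w = - repr x w}.
Proof. exact: oppE. Qed.

(* For [z z' : R[i]], [z <= z'] means that [z' - z] is a nonnegative real, so on
   real elements of [L0] this is the a.e. order. *)
Definition L0_le (x y : L0) : Prop := {ae mu, forall w, repr x w <= repr y w}.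

Definition L0_order_bounded (A : set L0) : Prop :=
  exists a b, forall x, A x -> L0_le a x /\ L0_le x b.

Definition L0_is_sup (A : set L0) (s : L0) : Prop :=
  (forall x, A x -> L0_le x s) /\
  (forall b, (forall x, A x -> L0_le x b) -> L0_le s b).

Definition L0_is_inf (A : set L0) (s : L0) : Prop :=
  (forall x, A x -> L0_le s x) /\
  (forall b, (forall x, A x -> L0_le b x) -> L0_le b s).

End L0.

Record hilbertSpace (R : realType) := HilbertSpace {
  hilbert_sort :> completeNormedModType R[i] ;
  hilb_dot : {dot hilbert_sort for Num.conj} ;
  hilb_dot_norm : forall x : hilbert_sort, `|x| ^+ 2 = hilb_dot x x }.

Section hilbert_theory.
Context (R : realType) (V : hilbertSpace R).
Implicit Types x y : V.

(* The norm of a normed module over [R[i]] takes values in [R[i]]. *)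
Definition hilb_norm x : R := complex.Re `|x|.

Lemma hilb_normE x : `|x| = (hilb_norm x)%:C%C.
Proof.
have := normr_ge0 x.
by rewrite /hilb_norm lecE /=; case: (`|x|) => a b /= /andP[/eqP -> _].
Qed.

Lemma hilb_norm_ge0 x : 0 <= hilb_norm x.
Proof. by rewrite -lecR -hilb_normE; exact: normr_ge0. Qed.

Lemma hilb_norm0 : hilb_norm 0 = 0.
Proof. by apply: complexI; rewrite -hilb_normE normr0. Qed.

Lemma hilb_normD x y : hilb_norm (x + y) <= hilb_norm x + hilb_norm y.
Proof. by rewrite -lecR rmorphD /= -!hilb_normE ler_normD. Qed.

Lemma hilb_norm_dist x y : `|hilb_norm x - hilb_norm y| <= hilb_norm (x - y).
Proof.
have h u v : hilb_norm u - hilb_norm v <= hilb_norm (u - v).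
  by rewrite lerBlDr; have := hilb_normD (u - v) v; rewrite subrK.
rewrite ler_norml h andbT lerNl opprB.
suff -> : hilb_norm (x - y) = hilb_norm (y - x) by [].
by apply: complexI; rewrite -!hilb_normE distrC.
Qed.

Lemma hilb_normZ (a : R[i]) x : hilb_norm (a *: x) = complex.Re `|a| * hilb_norm x.
Proof.
have a0 : complex.Im `|a| = 0.
  by have := normr_ge0 a; rewrite lecE /= => /andP[/eqP].
by rewrite /hilb_norm normrZ cReM a0 mul0r subr0.
Qed.

Lemma hilb_norm_sqr x : (hilb_norm x ^+ 2)%:C%C = hilb_dot V x x.
Proof. by rewrite rmorphXn /= -hilb_normE hilb_dot_norm. Qed.

Lemma hilb_dotDl x y z : hilb_dot V (x + y) z = hilb_dot V x z + hilb_dot V y z.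
Proof. exact: linearDl. Qed.
Lemma hilb_dotDr x y z : hilb_dot V x (y + z) = hilb_dot V x y + hilb_dot V x z.
Proof. exact: linearDr. Qed.
Lemma hilb_dotZl a x y : hilb_dot V (a *: x) y = a * hilb_dot V x y.
Proof. exact: linearZl_LR. Qed.
Lemma hilb_dotZr a x y : hilb_dot V x (a *: y) = a^* * hilb_dot V x y.
Proof. exact: linearZr. Qed.
Lemma hilb_dotC x y : hilb_dot V x y = (hilb_dot V y x)^*.
Proof. by rewrite (hermitian_subproof x y) expr0 mul1r. Qed.

Lemma Re_hilb_dot x y : complex.Re (hilb_dot V x y) =
  (hilb_norm (x + y) ^+ 2 - hilb_norm x ^+ 2 - hilb_norm y ^+ 2) / 2.
Proof.
have nE z : hilb_norm z ^+ 2 = complex.Re (hilb_dot V z z) by rewrite -hilb_norm_sqr.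
rewrite !nE hilb_dotDl !hilb_dotDr !cReD.
have -> : complex.Re (hilb_dot V y x) = complex.Re (hilb_dot V x y).
  by rewrite hilb_dotC; case: (hilb_dot V x y).
by field.
Qed.

Lemma Im_hilb_dot x y : complex.Im (hilb_dot V x y) =
  complex.Re (hilb_dot V x ('i%C *: y)).
Proof. by rewrite hilb_dotZr; case: (hilb_dot V x y) => a b; rewrite cReM/=; ring. Qed.

End hilbert_theory.
(* A section is encoded as a partial function, [None] marking the points
   outside its domain; hence equal sections have equal domains. *)
Record bsection d (T : measurableType d) (R : realType)
    (mu : {measure set T -> \bar R}) (H : T -> hilbertSpace R) := BSection {
  bsection_fun :> forall w, option (H w) ;
  bsection_ae : {ae mu, forall w, bsection_fun w} }.

Section sections.
Context d (T : measurableType d) (R : realType).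
Variables (mu : {measure set T -> \bar R}) (H : T -> hilbertSpace R).
Implicit Types (u v : bsection mu H) (f : T -> R[i]).

Definition sec_dom u : set T := [set w | u w].

Definition sec_val u (w : T) : H w := odflt 0 (u w).

Lemma sec_zero_ae : {ae mu, forall w, (fun=> Some 0 : option (H w)) w}.
Proof. exact: aeW. Qed.

Definition sec_zero : bsection mu H := BSection sec_zero_ae.

Definition sec_add_fun u v (w : T) : option (H w) :=
  match u w, v w with Some x, Some y => Some (x + y) | _, _ => None end.

Lemma sec_add_ae u v : {ae mu, forall w, sec_add_fun u v w}.
Proof.
apply: ae_imp2 (bsection_ae u) (bsection_ae v) => w; rewrite /sec_add_fun.
by case: (u w); case: (v w).
Qed.

Definition sec_add u v : bsection mu H := BSection (sec_add_ae u v).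

Definition sec_scale_fun f u (w : T) : option (H w) :=
  omap (fun x => f w *: x) (u w).

Lemma sec_scale_ae f u : {ae mu, forall w, sec_scale_fun f u w}.
Proof.
by apply: ae_imp1 (bsection_ae u) => w; rewrite /sec_scale_fun; case: (u w).
Qed.

Definition sec_scale f u : bsection mu H := BSection (sec_scale_ae f u).

Lemma bsection_eq u v : (forall w, u w = v w) -> u = v.
Proof.
case: u v => [u hu] [v hv] /= /(@functional_extensionality_dep _ _ _ _) uv.
by subst v; congr BSection; exact: Prop_irrelevance.
Qed.

Lemma sec_val0 w : sec_val sec_zero w = 0. Proof. by []. Qed.

Lemma sec_valZ f u w : sec_val (sec_scale f u) w = f w *: sec_val u w.
Proof. by rewrite /sec_val /= /sec_scale_fun; case: (u w); rewrite ?scaler0. Qed.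

Lemma sec_valD u v : {ae mu, forall w,
  sec_val (sec_add u v) w = sec_val u w + sec_val v w}.
Proof.
apply: ae_imp2 (bsection_ae u) (bsection_ae v) => w.
by rewrite /sec_val /= /sec_add_fun; case: (u w); case: (v w).
Qed.

Lemma sec_valP u v : {ae mu, forall w, sec_val u w = sec_val v w} <->
  {ae mu, forall w, u w = v w}.
Proof.
split; last by apply: ae_imp1 => w; rewrite /sec_val => ->.
move=> uv; apply: ae_imp3 (bsection_ae u) (bsection_ae v) uv => w.
by rewrite /sec_val; case: (u w); case: (v w) => //= a b _ _ ->.
Qed.

End sections.

(* [msec] is the set L of sections; it determines measurability. [measurable_fun]
   has content only on measurable sets, which domains are when [mu] is
   complete, being conegligible. *)
Record measurableBundle d (T : measurableType d) (R : realType)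
    (mu : {measure set T -> \bar R}) := MeasurableBundle {
  fiber :> T -> hilbertSpace R ;
  msec : set (bsection mu fiber) ;
  msec_lin : forall (a b : R[i]) c1 c2, msec c1 -> msec c2 ->
    msec (sec_add (sec_scale (cst a) c1) (sec_scale (cst b) c2)) ;
  msec_norm : forall c, msec c ->
    measurable_fun (sec_dom c) (fun w => hilb_norm (sec_val c w)) ;
  msec_dense : forall w,
    dense [set x : fiber w | exists2 c, msec c & c w = Some x] }.

Section measurable_sections.
Import HBSimple.
Context d (T : measurableType d) (R : realType).
Variables (mu : {measure set T -> \bar R}) (B : measurableBundle mu).
Implicit Types (u v s c : bsection mu B).

Definition is_step s : Prop :=
  exists n (A : 'I_n -> set T) (c : 'I_n -> bsection mu B),
    (forall i, measurable (A i) /\ msec (c i)) /\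
    s = \big[@sec_add _ _ _ _ _/sec_zero mu B]_(i < n)
          sec_scale (\1_(A i) : T -> R[i]) (c i).

(* [sec_val] is [0] outside the domain, which only affects a null set. *)
Definition is_measurable_section u : Prop :=
  exists s : nat -> bsection mu B, (forall n, is_step (s n)) /\
    {ae mu, forall w,
      (fun n => hilb_norm (sec_val (s n) w - sec_val u w)) @ \oo --> (0 : R)}.

Lemma is_step_ind (K : bsection mu B -> Prop) : K (sec_zero mu B) ->
  (forall u v, K u -> K v -> K (sec_add u v)) ->
  (forall A c, measurable A -> msec c -> K (sec_scale (\1_A : T -> R[i]) c)) ->
  forall s, is_step s -> K s.
Proof.
move=> K0 KD KA s [n [A [c [Ac ->]]]].
by elim/big_ind : _ => // i _; apply: KA; have [] := Ac i.
Qed.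

Lemma sec_addA u v s : sec_add u (sec_add v s) = sec_add (sec_add u v) s.
Proof.
apply: bsection_eq => w; rewrite /= /sec_add_fun /= /sec_add_fun.
by case: (u w); case: (v w); case: (s w) => // z y x; rewrite addrA.
Qed.

Lemma sec_add0 u : sec_add (sec_zero mu B) u = u.
Proof.
apply: bsection_eq => w; rewrite /= /sec_add_fun /=.
by case: (u w) => // x; rewrite add0r.
Qed.

Lemma sec_addr0 u : sec_add u (sec_zero mu B) = u.
Proof.
apply: bsection_eq => w; rewrite /= /sec_add_fun /=.
by case: (u w) => // x; rewrite addr0.
Qed.

Lemma is_step0 : is_step (sec_zero mu B).
Proof.
exists 0%N, (fun=> set0), (fun=> sec_zero mu B); split; last by rewrite big_ord0.
by case.
Qed.

Lemma is_stepD u v : is_step u -> is_step v -> is_step (sec_add u v).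
Proof.
move=> [n [A [c [Ac ->]]]] [m [A' [c' [Ac' ->]]]].
pose pick (X : Type) (a : 'I_n -> X) (b : 'I_m -> X) (i : 'I_(n + m)) : X :=
  match fintype.split i with inl j => a j | inr j => b j end.
exists (n + m)%N, (pick _ A A'), (pick _ c c'); split.
  by move=> i; rewrite /pick; case: fintype.split.
have idl : left_id (sec_zero mu B) (@sec_add _ _ _ mu B) by exact: sec_add0.
have idr : right_id (sec_zero mu B) (@sec_add _ _ _ mu B) by exact: sec_addr0.
have ass : associative (@sec_add _ _ _ mu B) by exact: sec_addA.
pose mix := Monoid.isLaw.Build _ _ _ ass idl idr.
pose law : Monoid.law (sec_zero mu B) := HB.pack (@sec_add _ _ _ mu B) mix.
rewrite -[@sec_add _ _ _ mu B]/(law : _ -> _ -> _) big_split_ord /=.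
congr (sec_add _ _); apply: eq_bigr => i _; rewrite /pick.
- by rewrite (unsplitK (inl i)).
- by rewrite (unsplitK (inr i)).
Qed.

Lemma is_step1 A c : measurable A -> msec c ->
  is_step (sec_scale (\1_A : T -> R[i]) c).
Proof.
move=> mA mc; exists 1%N, (fun=> A), (fun=> c); split => //.
by rewrite big_ord_recl big_ord0 sec_addr0.
Qed.

Lemma msecZ (a : R[i]) c : msec c -> msec (sec_scale (cst a) c).
Proof.
move=> mc; have := msec_lin a 0 mc mc.
congr (msec _); apply: bsection_eq => w; rewrite /= /sec_add_fun /= /sec_scale_fun.
by case: (c w) => //= x; rewrite scale0r addr0.
Qed.

Lemma sec_scale0 (f : T -> R[i]) : sec_scale f (sec_zero mu B) = sec_zero mu B.
Proof. by apply: bsection_eq => w; rewrite /= /sec_scale_fun /= scaler0. Qed.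

Lemma sec_scaleDr (f : T -> R[i]) u v :
  sec_scale f (sec_add u v) = sec_add (sec_scale f u) (sec_scale f v).
Proof.
apply: bsection_eq => w; rewrite /= /sec_add_fun /= /sec_scale_fun /=.
by rewrite /sec_add_fun; case: (u w); case: (v w) => // *; rewrite /= scalerDr.
Qed.

Lemma sec_scaleDl (f g : T -> R[i]) u :
  sec_scale (fun w => f w + g w) u = sec_add (sec_scale f u) (sec_scale g u).
Proof.
apply: bsection_eq => w; rewrite /= /sec_add_fun /= /sec_scale_fun /=.
by case: (u w) => // *; rewrite /= scalerDl.
Qed.

Lemma sec_scaleA (f g : T -> R[i]) u :
  sec_scale f (sec_scale g u) = sec_scale (fun w => f w * g w) u.
Proof.
apply: bsection_eq => w; rewrite /= /sec_scale_fun /= /sec_scale_fun.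
by case: (u w) => // *; rewrite /= scalerA.
Qed.

Lemma Re_norm_le (z : R[i]) :
  complex.Re `|z| <= `|complex.Re z| + `|complex.Im z|.
Proof.
case: z => a b; rewrite normc_def /= -ler_sqr ?nnegrE ?sqrtr_ge0 ?addr_ge0//.
rewrite sqr_sqrtr ?addr_ge0 ?sqr_ge0// sqrrD !real_normK ?num_real//.
by rewrite lerD2r lerDl mulrn_wge0// mulr_ge0.
Qed.

Let stepper (f : T -> R[i]) := forall s, is_step s -> is_step (sec_scale f s).

Let stepperD f g : stepper f -> stepper g -> stepper (fun w => f w + g w).
Proof.
by move=> sf sg s ss; rewrite sec_scaleDl; apply: is_stepD; [exact: sf|exact: sg].
Qed.

Let stepperM f g : stepper f -> stepper g -> stepper (fun w => f w * g w).
Proof. by move=> sf sg s ss; rewrite -sec_scaleA; apply/sf/sg. Qed.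

Let stepper_cst a : stepper (cst a).
Proof.
apply: is_step_ind => [|u v ku kv|A c mA mc].
- by rewrite sec_scale0; exact: is_step0.
- by rewrite sec_scaleDr; exact: is_stepD.
- rewrite sec_scaleA.
  rewrite (_ : (fun w => _) = (fun w => \1_A w * cst a w)); last first.
    by apply/funext => w; rewrite mulrC.
  by rewrite -sec_scaleA; apply: is_step1 => //; exact: msecZ.
Qed.

Let stepper_indic A : measurable A -> stepper (\1_A : T -> R[i]).
Proof.
move=> mA; apply: is_step_ind => [|u v ku kv|A' c mA' mc].
- by rewrite sec_scale0; exact: is_step0.
- by rewrite sec_scaleDr; exact: is_stepD.
- rewrite sec_scaleA (_ : (fun w => _) = \1_(A `&` A')).
    by apply: is_step1 => //; exact: measurableI.
  by apply/funext => w; rewrite indicI.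
Qed.

Let stepper_sfun (f : {sfun T >-> R}) : stepper (fun w => (f w)%:C%C).
Proof.
have -> : (fun w => (f w)%:C%C) =
    (fun w => \sum_(y <- finmap.enum_fset (fset_set (range f)))
       (y%:C%C * \1_(f @^-1` [set y]) w)).
  apply/funext => w; rewrite [in LHS]fimfunE fsbig_finite //=.
  rewrite rmorph_sum /=; apply: eq_bigr => y _.
  by rewrite rmorphM /= !indicE; case: (_ \in _).
elim: (finmap.enum_fset _) => [|y s ih].
  by under eq_fun do rewrite big_nil; exact: stepper_cst.
under eq_fun do rewrite big_cons.
apply: stepperD => //; apply: stepperM; first exact: stepper_cst.
exact: stepper_indic.
Qed.

Lemma is_measurable_section0 : is_measurable_section (sec_zero mu B).
Proof.
exists (fun=> sec_zero mu B); split => [n|]; first exact: is_step0.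
apply: aeW => w; rewrite sec_val0 subr0 hilb_norm0; exact: cvg_cst.
Qed.

Lemma is_measurable_sectionD u v : is_measurable_section u ->
  is_measurable_section v -> is_measurable_section (sec_add u v).
Proof.
move=> [s [ss su]] [t [st tv]]; exists (fun n => sec_add (s n) (t n)); split.
  by move=> n; exact: is_stepD.
have sD := ae_foralln (fun n => sec_valD (s n) (t n)).
apply: ae_imp3 su tv (ae_imp2 _ (sec_valD u v) sD) => [|w]; last first.
  move=> uv st'; exact: (conj uv st').
move=> w su tv [uv st']; rewrite uv.
apply: (@squeeze_cvgr _ _ _ _ (cst 0) (fun n =>
  hilb_norm (sec_val (s n) w - sec_val u w) + hilb_norm (sec_val (t n) w - sec_val v w))).
- apply: nearW => n; rewrite hilb_norm_ge0 /= st'.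
  have -> : sec_val (s n) w + sec_val (t n) w - (sec_val u w + sec_val v w) =
      (sec_val (s n) w - sec_val u w) + (sec_val (t n) w - sec_val v w).
    by rewrite opprD addrACA.
  exact: hilb_normD.
- exact: cvg_cst.
- by rewrite -[X in _ --> X]addr0; exact: cvgD.
Qed.

Lemma complex_sfun_approx (f : T -> R[i]) : cmeasurable f ->
  exists g : nat -> T -> R[i], (forall n, stepper (g n)) /\
    forall w, (fun n => complex.Re `|g n w - f w|) @ \oo --> (0 : R).
Proof.
move=> [mr mi].
have /approximation_sfun[//|p pr] :
    measurable_fun setT (EFin \o (fun w => complex.Re (f w))).
  exact/measurable_EFinP.
have /approximation_sfun[//|q qi] :
    measurable_fun setT (EFin \o (fun w => complex.Im (f w))).
  exact/measurable_EFinP.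
exists (fun n w => (p n w)%:C%C + 'i%C * (q n w)%:C%C); split=> [n|w].
  by apply: stepperD => //; apply: stepperM => //; exact: stepper_cst.
have {}pr : (fun n => p n w) @ \oo --> complex.Re (f w).
  by have /fine_cvgP[_] := pr w I.
have {}qi : (fun n => q n w) @ \oo --> complex.Im (f w).
  by have /fine_cvgP[_] := qi w I.
apply: (@squeeze_cvgr _ _ _ _ (cst 0) (fun n =>
  `|p n w - complex.Re (f w)| + `|q n w - complex.Im (f w)|)).
- apply: nearW => n; apply/andP; split.
    by have := normr_ge0 ((p n w)%:C%C + 'i%C * (q n w)%:C%C - f w);
       rewrite lecE /= => /andP[].
  apply: le_trans (Re_norm_le _) _.
  by case: (f w) => a b; rewrite !cReD !cImD cReM cImM /= ?mul0r ?mul1r ?sub0r ?subr0 ?add0r ?addr0 ?oppr0 ?subrr.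
- exact: cvg_cst.
- rewrite -[X in _ --> X]addr0; apply: cvgD.
  + by apply/norm_cvg0P; rewrite -[X in _ --> X](subrr (complex.Re (f w)));
      apply: cvgB => //; exact: cvg_cst.
  + by apply/norm_cvg0P; rewrite -[X in _ --> X](subrr (complex.Im (f w)));
      apply: cvgB => //; exact: cvg_cst.
Qed.

Lemma is_measurable_sectionZ (f : T -> R[i]) u : cmeasurable f ->
  is_measurable_section u -> is_measurable_section (sec_scale f u).
Proof.
move=> /complex_sfun_approx[g [gstep gf]] [s [ss su]].
exists (fun n => sec_scale (g n) (s n)); split=> [n|]; first exact: gstep.
apply: ae_imp1 su => w su.
apply: (@squeeze_cvgr _ _ _ _ (cst 0) (fun n =>
  (complex.Re `|g n w - f w| + complex.Re `|f w|) *
    hilb_norm (sec_val (s n) w - sec_val u w) +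
  complex.Re `|g n w - f w| * hilb_norm (sec_val u w))).
- apply: nearW => n; rewrite hilb_norm_ge0 /= !sec_valZ.
  have -> : g n w *: sec_val (s n) w - f w *: sec_val u w =
      g n w *: (sec_val (s n) w - sec_val u w) + (g n w - f w) *: sec_val u w.
    by rewrite scalerBr scalerBl addrA subrK.
  apply: le_trans (hilb_normD _ _) _; rewrite !hilb_normZ lerD2r.
  apply: ler_wpM2r; first exact: hilb_norm_ge0.
  have := ler_normD (g n w - f w) (f w).
  by rewrite subrK lecE cReD => /andP[].
- exact: cvg_cst.
- rewrite -[X in _ --> X]addr0 -[X in _ --> X + _](mulr0 (0 + complex.Re `|f w|)).
  rewrite -[X in _ --> _ + X](mul0r (hilb_norm (sec_val u w))).
  apply: cvgD; apply: cvgM => //; last exact: cvg_cst.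
  by apply: cvgD => //; exact: cvg_cst.
Qed.

End measurable_sections.

Section complete_measure.
Context d (T : measurableType d) (R : realType).
Variables (mu : {measure set T -> \bar R}) (B : measurableBundle mu).
Hypothesis cmu : measure_is_complete mu.
Implicit Types (u v s c : bsection mu B).

Lemma ae_eq_measurable (f g : T -> R) : {ae mu, forall w, f w = g w} ->
  measurable_fun setT f -> measurable_fun setT g.
Proof.
move=> fg /measurable_EFinP mf; apply/measurable_EFinP.
by apply: (ae_measurable_fun cmu) mf; apply: ae_imp1 fg => w /= ->.
Qed.

Lemma ae_eq_cmeasurable (f g : T -> R[i]) : {ae mu, forall w, f w = g w} ->
  cmeasurable f -> cmeasurable g.
Proof.
by move=> fg [fr fi]; split; [apply: ae_eq_measurable fr|
  apply: ae_eq_measurable fi]; apply: ae_imp1 fg => w ->.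
Qed.

Lemma ae_cvg_measurable (h : nat -> T -> R) (f : T -> R) :
  (forall n, measurable_fun setT (h n)) ->
  {ae mu, forall w, (fun n => h n w) @ \oo --> f w} -> measurable_fun setT f.
Proof.
move=> mh hf; pose D := [set w | (fun n => h n w) @ \oo --> f w].
have mD : measurable D by rewrite -(setCK D); apply/measurableC/cmu.
apply: (@ae_eq_measurable (f \* \1_D)).
  by apply: ae_imp1 hf => w Dw /=; rewrite indicE mem_set ?mulr1.
apply: (@measurable_fun_cvg _ _ _ _ (fun n => h n \* \1_D)) => [n|w _].
  by apply: measurable_funM => //; exact: measurable_indic.
rewrite /= indicE; have [Dw|Dw] := boolP (w \in D).
  rewrite mulr1; under eq_fun do rewrite mulr1; exact: (set_mem Dw).
by rewrite mulr0; under eq_fun do rewrite mulr0; exact: cvg_cst.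
Qed.

Let normm u := measurable_fun setT (fun w => hilb_norm (sec_val u w)).
Let dotm u v :=
  cmeasurable (fun w => hilb_dot (B w) (sec_val u w) (sec_val v w)).

Let polar u v : normm u -> normm v -> normm (sec_add u v) ->
  measurable_fun setT
    (fun w => complex.Re (hilb_dot (B w) (sec_val u w) (sec_val v w))).
Proof.
move=> mu_ mv muv; under eq_fun do rewrite Re_hilb_dot.
apply: measurable_funM; last exact: measurable_cst.
apply: measurable_funB; last exact: measurable_funX.
apply: measurable_funB; last exact: measurable_funX.
apply: (@ae_eq_measurable (fun w => hilb_norm (sec_val (sec_add u v) w) ^+ 2)).
  by apply: ae_imp1 (sec_valD u v) => w ->.
exact: measurable_funX.
Qed.

Let polar_dotm u v : normm u -> normm v -> normm (sec_add u v) ->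
  normm (sec_scale (cst 'i%C) v) ->
  normm (sec_add u (sec_scale (cst 'i%C) v)) -> dotm u v.
Proof.
move=> mu_ mv muv miv muiv; split; first exact: polar.
under eq_fun do rewrite Im_hilb_dot; have := polar mu_ miv muiv.
by under eq_fun do rewrite sec_valZ.
Qed.

Let msec_normm c : msec c -> normm c.
Proof.
move=> mc; have mD : measurable (sec_dom c).
  by rewrite -(setCK (sec_dom c)); apply/measurableC/cmu; exact: bsection_ae.
move=> _ Y mY; rewrite setTI -(setUIDK (_ @^-1` _) (sec_dom c)).
apply: measurableU; first by rewrite setIC; exact: msec_norm.
apply: cmu; apply: negligibleS (bsection_ae c); exact: subIsetr.
Qed.

Let msecD c1 c2 : msec c1 -> msec c2 -> msec (sec_add c1 c2).
Proof.
move=> m1 m2; have := msec_lin 1 1 m1 m2; congr (msec _).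
apply: bsection_eq => w; rewrite /= /sec_add_fun /= /sec_scale_fun.
by case: (c1 w); case: (c2 w) => //= *; rewrite !scale1r.
Qed.

Let msec_dotm c1 c2 : msec c1 -> msec c2 -> dotm c1 c2.
Proof.
move=> m1 m2; have m2i := msecZ 'i%C m2.
by apply: polar_dotm; apply: msec_normm => //; exact: msecD.
Qed.

Let cmeasurable_indic A : measurable A -> cmeasurable (\1_A : T -> R[i]).
Proof.
move=> mA; split.
- rewrite (_ : (fun w => _) = (\1_A : T -> R)); first exact: measurable_indic.
  by apply/funext => w; rewrite !indicE; case: (_ \in _).
- rewrite (_ : (fun w => _) = cst (0 : R)); first exact: measurable_cst.
  by apply/funext => w; rewrite !indicE; case: (_ \in _).
Qed.

Let step_dotm s : is_step s -> forall t, is_step t -> dotm s t.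
Proof.
apply: (is_step_ind (K := fun s => forall t, is_step t -> dotm s t))
  => [t st|u v ku kv t st|A c mA mc].
- rewrite /dotm; under eq_fun do rewrite sec_val0 linear0l.
  exact: cmeasurable_cst.
- apply: ae_eq_cmeasurable (cmeasurableD (ku t st) (kv t st)).
  by apply: ae_imp1 (sec_valD u v) => w ->; rewrite hilb_dotDl.
- apply: (is_step_ind (K := dotm _)) => [|u v ku kv|A' c' mA' mc'].
  + rewrite /dotm; under eq_fun do rewrite sec_val0 linear0r.
    exact: cmeasurable_cst.
  + apply: ae_eq_cmeasurable (cmeasurableD ku kv).
    by apply: ae_imp1 (sec_valD u v) => w ->; rewrite hilb_dotDr.
  + rewrite /dotm; under eq_fun do rewrite !sec_valZ hilb_dotZl hilb_dotZr.
    apply: cmeasurableM; first exact: cmeasurable_indic.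
    rewrite (_ : (fun w => _) = (fun w => \1_A' w *
      hilb_dot (B w) (sec_val c w) (sec_val c' w))).
      by apply: cmeasurableM; [exact: cmeasurable_indic|exact: msec_dotm].
    by apply/funext => w; rewrite indicE conjC_nat.
Qed.

Let step_normm s : is_step s -> normm s.
Proof.
move=> ss; have [h _] := step_dotm ss ss.
rewrite /normm (_ : (fun w => _) = Num.sqrt \o
    (fun w => complex.Re (hilb_dot (B w) (sec_val s w) (sec_val s w)))).
  apply: measurableT_comp h.
  exact: (continuous_measurable_fun (@sqrt_continuous R)).
apply/funext => w /=; rewrite -hilb_norm_sqr /= sqrtr_sqr.
by rewrite ger0_norm ?hilb_norm_ge0.
Qed.

Lemma measurable_section_norm u : is_measurable_section u ->
  measurable_fun setT (fun w => hilb_norm (sec_val u w)).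
Proof.
move=> [s [ss su]].
apply: (ae_cvg_measurable (h := fun n w => hilb_norm (sec_val (s n) w))).
  by move=> n; exact: step_normm.
apply: ae_imp1 su => w su; apply/subr_cvg0/norm_cvg0P.
apply: squeeze_cvgr su; last exact: cvg_cst.
by apply: nearW => n; rewrite normr_ge0 hilb_norm_dist.
Qed.

Lemma measurable_section_dot u v :
  is_measurable_section u -> is_measurable_section v ->
  cmeasurable (fun w => hilb_dot (B w) (sec_val u w) (sec_val v w)).
Proof.
move=> mu_ mv.
have miv := is_measurable_sectionZ (cmeasurable_cst T 'i%C) mv.
by apply: polar_dotm; apply: measurable_section_norm => //;
  exact: is_measurable_sectionD.
Qed.

Lemma measurable_section_cnorm u : is_measurable_section u ->
  cmeasurable (fun w => `|sec_val u w|).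
Proof.
move=> mu_; under eq_fun do rewrite hilb_normE.
by split; [exact: measurable_section_norm|exact: measurable_cst].
Qed.

End complete_measure.

Record msection d (T : measurableType d) (R : realType)
    (mu : {measure set T -> \bar R}) (B : measurableBundle mu) := MSection {
  msection_val :> bsection mu B ;
  msectionP : is_measurable_section msection_val }.

HB.instance Definition _ d (T : measurableType d) (R : realType)
  (mu : {measure set T -> \bar R}) (B : measurableBundle mu) :=
  gen_eqMixin (msection B).
HB.instance Definition _ d (T : measurableType d) (R : realType)
  (mu : {measure set T -> \bar R}) (B : measurableBundle mu) :=
  gen_choiceMixin (msection B).

Section L0H.
Context d (T : measurableType d) (R : realType).
Variables (mu : {measure set T -> \bar R}) (B : measurableBundle mu).

Definition L0H_eqv (u v : msection B) : bool :=
  `[< {ae mu, forall w, u w = v w} >].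

Let L0H_eqv_refl : reflexive L0H_eqv.
Proof. by move=> f; apply/asboolP; exact: aeW. Qed.

Let L0H_eqv_sym : symmetric L0H_eqv.
Proof. by move=> f g; apply/asboolP/asboolP; apply: ae_imp1 => w ->. Qed.

Let L0H_eqv_trans : transitive L0H_eqv.
Proof.
by move=> f g h /asboolP gf /asboolP fh; apply/asboolP;
  apply: ae_imp2 gf fh => w -> ->.
Qed.

Canonical L0H_equiv := EquivRel L0H_eqv L0H_eqv_refl L0H_eqv_sym L0H_eqv_trans.

Definition L0H : Type := {eq_quot L0H_eqv}.
HB.instance Definition _ := Choice.on L0H.
HB.instance Definition _ := EqQuotient.on L0H.

Definition L0H_class u (um : is_measurable_section u) : L0H :=
  \pi_L0H (MSection um).

Definition L0H_val (x : L0H) (w : T) : B w := sec_val (repr x) w.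

Lemma L0HP (x y : L0H) :
  {ae mu, forall w, L0H_val x w = L0H_val y w} <-> x = y.
Proof.
split=> [/sec_valP xy|->]; last exact: aeW.
by rewrite -(reprK x) -(reprK y); apply/eqmodP/asboolP.
Qed.

Lemma L0H_classE u (um : is_measurable_section u) :
  {ae mu, forall w, L0H_val (L0H_class um) w = sec_val u w}.
Proof.
apply/sec_valP.
have /eqmodP/asboolP : repr (L0H_class um) = MSection um %[mod L0H].
  by rewrite reprK.
by [].
Qed.

Definition L0H_zero : L0H := L0H_class (is_measurable_section0 B).
Definition L0H_add (x y : L0H) : L0H :=
  L0H_class (is_measurable_sectionD (msectionP (repr x)) (msectionP (repr y))).
Definition L0H_scale (a : L0 mu) (x : L0H) : L0H :=
  L0H_class (is_measurable_sectionZ (cmfunP (repr a)) (msectionP (repr x))).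
Definition L0H_opp (x : L0H) : L0H := L0H_scale (L0_cst mu (-1)) x.

Let addE x y : {ae mu, forall w,
  L0H_val (L0H_add x y) w = L0H_val x w + L0H_val y w}.
Proof.
apply: ae_imp2 (L0H_classE (is_measurable_sectionD (msectionP (repr x))
  (msectionP (repr y)))) (sec_valD (repr x) (repr y)) => w /= xy <-.
exact: xy.
Qed.

Let scaleE a x : {ae mu, forall w,
  L0H_val (L0H_scale a x) w = repr a w *: L0H_val x w}.
Proof.
apply: ae_imp1 (L0H_classE (is_measurable_sectionZ (cmfunP (repr a))
  (msectionP (repr x)))) => w ax.
by rewrite /L0H_val -sec_valZ; exact: ax.
Qed.

Let zeroE : {ae mu, forall w, L0H_val L0H_zero w = 0}.
Proof. by apply: ae_imp1 (L0H_classE (is_measurable_section0 B)) => w ->. Qed.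

Let oppE x : {ae mu, forall w, L0H_val (L0H_opp x) w = - L0H_val x w}.
Proof.
by apply: ae_imp2 (scaleE (L0_cst mu (-1)) x) (L0_cstE mu (-1)) => w -> ->; rewrite scaleN1r.
Qed.

Let addA : associative L0H_add.
Proof.
move=> x y z; apply/L0HP; near=> w.
rewrite (near (addE x (L0H_add y z)) w) // (near (addE y z) w) //.
rewrite (near (addE (L0H_add x y) z) w) // (near (addE x y) w) //.
by rewrite addrA.
Unshelve. all: by end_near. Qed.

Let addC : commutative L0H_add.
Proof.
move=> x y; apply/L0HP; near=> w.
by rewrite (near (addE x y) w) // (near (addE y x) w) // addrC.
Unshelve. all: by end_near. Qed.

Let add0 : left_id L0H_zero L0H_add.
Proof.
move=> x; apply/L0HP; near=> w.
by rewrite (near (addE L0H_zero x) w) // (near zeroE w) // add0r.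
Unshelve. all: by end_near. Qed.

Let addN : left_inverse L0H_zero L0H_opp L0H_add.
Proof.
move=> x; apply/L0HP; near=> w.
rewrite (near (addE (L0H_opp x) x) w) // (near (oppE x) w) //.
by rewrite (near zeroE w) // addNr.
Unshelve. all: by end_near. Qed.

HB.instance Definition _ := GRing.isZmodule.Build L0H addA addC add0 addN.

Let scaleA a b x : L0H_scale a (L0H_scale b x) = L0H_scale (a * b) x.
Proof.
apply/L0HP; near=> w.
rewrite (near (scaleE a (L0H_scale b x)) w) // (near (scaleE b x) w) //.
by rewrite (near (scaleE (a * b) x) w) // (near (L0_mulE a b) w) // scalerA.
Unshelve. all: by end_near. Qed.

Let scale1 : left_id 1 L0H_scale.
Proof.
move=> x; apply/L0HP; near=> w.
by rewrite (near (scaleE 1 x) w) // (near (L0_1E mu) w) // scale1r.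
Unshelve. all: by end_near. Qed.

Let scaleDr : right_distributive L0H_scale +%R.
Proof.
move=> a x y; apply/L0HP; near=> w.
rewrite (near (scaleE a (x + y)) w) // (near (addE x y) w) //.
rewrite (near (addE (L0H_scale a x) (L0H_scale a y)) w) //.
by rewrite (near (scaleE a x) w) // (near (scaleE a y) w) // scalerDr.
Unshelve. all: by end_near. Qed.

Let scaleDl x : {morph L0H_scale^~ x : a b / a + b}.
Proof.
move=> a b; apply/L0HP; near=> w.
rewrite (near (scaleE (a + b) x) w) // (near (L0_addE a b) w) //.
rewrite (near (addE (L0H_scale a x) (L0H_scale b x)) w) //.
by rewrite (near (scaleE a x) w) // (near (scaleE b x) w) // scalerDl.
Unshelve. all: by end_near. Qed.

HB.instance Definition _ := GRing.Zmodule_isLmodule.Build (L0 mu) L0H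
  scaleA scale1 scaleDr scaleDl.

Lemma L0H_0E : {ae mu, forall w, L0H_val 0 w = 0}.
Proof. exact: zeroE. Qed.

Lemma L0H_addE (x y : L0H) :
  {ae mu, forall w, L0H_val (x + y) w = L0H_val x w + L0H_val y w}.
Proof. exact: addE. Qed.

Lemma L0H_oppE (x : L0H) : {ae mu, forall w, L0H_val (- x) w = - L0H_val x w}.
Proof. exact: oppE. Qed.

Lemma L0H_scaleE (a : L0 mu) (x : L0H) :
  {ae mu, forall w, L0H_val (a *: x) w = repr a w *: L0H_val x w}.
Proof. exact: scaleE. Qed.

End L0H.

Section operators.
Context d (T : measurableType d) (R : realType).
Variables (mu : {measure set T -> \bar R}) (B : measurableBundle mu).
Hypothesis cmu : measure_is_complete mu.
Implicit Types x y : L0H B.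

Definition L0_dot x y : L0 mu := L0_class mu
  (measurable_section_dot cmu (msectionP (repr x)) (msectionP (repr y))).

Definition L0_norm x : L0 mu := L0_class mu
  (measurable_section_cnorm cmu (msectionP (repr x))).

Lemma L0_dotE x y : {ae mu, forall w,
  repr (L0_dot x y) w = hilb_dot (B w) (L0H_val x w) (L0H_val y w)}.
Proof. exact: L0_classE. Qed.

Lemma L0_normE x : {ae mu, forall w, repr (L0_norm x) w = `|L0H_val x w|}.
Proof. exact: L0_classE. Qed.

(* [L0_norm x] is the nonnegative square root of [L0_dot x x]. *)
Lemma L0_norm_ge0 x : L0_le 0 (L0_norm x).
Proof.
by apply: ae_imp2 (L0_0E mu) (L0_normE x) => w -> ->; exact: normr_ge0.
Qed.

Lemma L0_norm_sqr x : L0_norm x ^+ 2 = L0_dot x x.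
Proof.
apply/L0P; rewrite expr2; near=> w.
rewrite (near (L0_mulE (L0_norm x) (L0_norm x)) w) // (near (L0_normE x) w) //.
by rewrite (near (L0_dotE x x) w) // -expr2 hilb_dot_norm.
Unshelve. all: by end_near. Qed.

Definition L0_bounded_set (S : set (L0H B)) : Prop :=
  L0_order_bounded (L0_norm @` S).

Definition L0_bounded_op (A : {linear L0H B -> L0H B}) : Prop :=
  forall S, L0_bounded_set S -> L0_bounded_set (A @` S).

(* The operator norm as a relation: an [L0_bounded_op] has exactly one such [s],
   since [L0 mu] is Dedekind complete when [mu] is finite. *)
Definition L0_is_opnorm (A : {linear L0H B -> L0H B}) (s : L0 mu) : Prop :=
  L0_is_sup [set L0_norm (A x) | x in [set x | L0_le (L0_norm x) 1]] s.

Definition L0_contraction (A : {linear L0H B -> L0H B}) : Prop :=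
  L0_bounded_op A /\ exists2 s, L0_is_opnorm A s & L0_le s 1.

Definition L0_projection (P : {linear L0H B -> L0H B}) : Prop :=
  [/\ L0_bounded_op P, (forall x, P (P x) = P x) &
      forall x y, L0_dot (P x) y = L0_dot x (P y)].

(* Order convergence to 0 of the norms [L0_norm (x n - l)]: they are dominated
   by some [e n] decreasing to 0 in [L0 mu]. *)
Definition bo_cvg (x : nat -> L0H B) (l : L0H B) : Prop :=
  exists e : nat -> L0 mu, [/\ forall n, L0_le (e n.+1) (e n),
    L0_is_inf (range e) 0 & forall n, L0_le (L0_norm (x n - l)) (e n)].

End operators.

Definition ergodic_mean d (T : measurableType d) (R : realType)
    (mu : {measure set T -> \bar R}) (B : measurableBundle mu)
    (A : {linear L0H B -> L0H B}) (n : nat) (u : L0H B) : L0H B :=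
  L0_cst mu n%:R^-1 *: \sum_(0 <= k < n) iter k A u.

(* Main.v *)
Require Import Defs.
From HB Require Import structures.
From mathcomp Require Import all_boot all_order all_algebra.
From mathcomp Require Import all_classical all_reals all_analysis.
From mathcomp Require Import measurable_realfun.
From mathcomp Require Import ring lra complex.

(* Riesz's proof of the mean ergodic theorem, carried out fibrewise although [T]
   itself does not act on the fibres.  Testing [T] on [(|x| + 1/n)^-1 x] shows
   that [|T x| <= |x|] almost everywhere.  For a midpoint [y] of two ergodic means
   of [u], the difference [u - y] is a combination of coboundaries [v - T v], so
   its ergodic sums stay bounded at almost every point and
   [|A_n u| <= |A_n y| + O(1/n) <= |y| + O(1/n)].  Hence [|A_n u|] tends pointwise
   to the infimum of the norms of the countably many such midpoints, and by the
   parallelogram law [A_n u] is Cauchy in almost every fibre.  The limit is a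
   measurable section by a Borel-Cantelli diagonal argument, it is fixed by [T],
   and an idempotent contraction is self-adjoint. *)

Set Implicit Arguments.
Unset Strict Implicit.
Unset Printing Implicit Defensive.

Import Order.TTheory GRing.Theory Num.Theory.
Import numFieldNormedType.Exports.

Local Open Scope classical_set_scope.
Local Open Scope ring_scope.

(** * Norm identities and Cauchy sequences in a single fibre *)

Section hilbert.
Context (R : realType) (V : hilbertSpace R).
Implicit Types x y : V.

Lemma hilb_normN x : hilb_norm (- x) = hilb_norm x.
Proof. by apply: complexI; rewrite -!hilb_normE normrN. Qed.

Lemma hilb_normB x y : hilb_norm (x - y) = hilb_norm (y - x).
Proof. by rewrite -hilb_normN opprB. Qed.

Lemma hilb_normZ_real (a : R) x : 0 <= a ->
  hilb_norm (a%:C%C *: x) = a * hilb_norm x.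
Proof. by move=> a0; rewrite hilb_normZ ger0_norm ?lecR. Qed.

Lemma hilb_norm_eq0 x : (hilb_norm x == 0) = (x == 0).
Proof.
apply/eqP/eqP => [x0|->]; last exact: hilb_norm0.
by apply/eqP; rewrite -normr_eq0 hilb_normE x0.
Qed.

Lemma hilb_norm_sqrD x y : hilb_norm (x + y) ^+ 2 =
  hilb_norm x ^+ 2 + hilb_norm y ^+ 2 + 2 * complex.Re (hilb_dot V x y).
Proof. by rewrite Re_hilb_dot; field. Qed.

Lemma hilb_dotNr x y : hilb_dot V x (- y) = - hilb_dot V x y.
Proof. by rewrite -scaleN1r hilb_dotZr rmorphN rmorph1 mulN1r. Qed.

Lemma parallelogram x y : hilb_norm (x + y) ^+ 2 + hilb_norm (x - y) ^+ 2 =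
  2 * (hilb_norm x ^+ 2 + hilb_norm y ^+ 2).
Proof.
rewrite !hilb_norm_sqrD hilb_normN hilb_dotNr.
by case: (hilb_dot V x y) => a b /=; ring.
Qed.

Lemma hilb_cauchy_cvg (a : nat -> V) :
  (forall e : R, 0 < e -> exists N, forall m n, (N <= m)%N -> (N <= n)%N ->
    hilb_norm (a m - a n) < e) ->
  exists l, (fun n => hilb_norm (a n - l)) @ \oo --> (0 : R).
Proof.
move=> ca.
have [l al] : exists l : V, a @ \oo --> l.
  apply/cvg_ex/cauchy_cvgP/cauchy_exP => e e0.
  (* The radius lives in [R[i]]; being positive there, it has zero imaginary part. *)
  have [r er] : exists r, e = r%:C%C.
    exists (complex.Re e); have := ltW e0.
    by rewrite lecE /=; case: (e) => x y /= /andP[/eqP -> _].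
  move: e0; rewrite er ltcR => /ca[N aN]; exists (a N).
  exists N => // n /= Nn.
  by rewrite -ball_normE /= hilb_normE ltcR; exact: aN.
exists l; apply/cvgrPdist_lt => e e0.
have e0' : 0 < e%:C%C by rewrite ltcR.
move/cvgrPdist_lt : al => /(_ _ e0'); apply: filterS => n.
by rewrite hilb_normE ltcR sub0r normrN ger0_norm ?hilb_norm_ge0// hilb_normB.
Qed.

(* Riesz's argument: the hypothesis forces [hilb_norm (a n)] to the infimum of the
   norms of the midpoints, and then the parallelogram law applies. *)
Lemma midpoint_cvg (a : nat -> V) :
  (forall p q, exists C : R, forall n,
    hilb_norm (a n) <= hilb_norm (2^-1%:C%C *: (a p + a q)) + C / n.+1%:R) ->
  exists l, (fun n => hilb_norm (a n - l)) @ \oo --> (0 : R).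
Proof.
move=> aC; apply: hilb_cauchy_cvg => e e0.
pose S := [set hilb_norm (2^-1%:C%C *: (a pq.1 + a pq.2))
  | pq in [set: nat * nat]].
pose del := inf S.
have S0 : S !=set0.
  by exists (hilb_norm (2^-1%:C%C *: (a 0%N + a 0%N))), (0, 0)%N.
have Slb : has_lbound S by exists 0 => _ [pq _ <-]; exact: hilb_norm_ge0.
have del0 : 0 <= del by apply: lb_le_inf => // _ [pq _ <-]; exact: hilb_norm_ge0.
(* The parallelogram law will bound the squared distance by [4 (del + 2 eta)^2 - 4 del^2 = 16 eta
   (del + eta)], which this choice keeps below [e^2]. One [eta] is spent on a nearly minimal
   midpoint, the other on the error [C / n.+1]. *)
pose eta := Num.min 1 (e ^+ 2 / (32 * (del + 1))).
have d1 : 0 < 32 * (del + 1) by rewrite mulr_gt0// ltr_wpDl.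
have eta0 : 0 < eta by rewrite lt_min ltr01 divr_gt0// exprn_gt0.
have eta1 : eta <= 1 by rewrite ge_min lexx.
have etae : eta * (32 * (del + 1)) <= e ^+ 2.
  by rewrite -ler_pdivlMr// ge_min lexx orbT.
have [_ [[p q] _ <-] /= pq] := inf_adherent eta0 (conj S0 Slb).
have [C aCpq] := aC p q.
have [N aN] : exists N, forall n, (N <= n)%N -> hilb_norm (a n) < del + eta + eta.
  have : (fun n => C * n.+1%:R^-1) @ \oo --> (C * 0 : R).
    by apply: cvgM; [exact: cvg_cst|exact: cvg_harmonic].
  rewrite mulr0 => /cvgr_lt /(_ _ eta0)[N _ hN]; exists N => n Nn.
  apply: le_lt_trans (aCpq n) _; apply: ltrD => //; exact: hN.
exists N => m n Nm Nn.
rewrite -(ltr_pXn2r (n := 2))// ?nnegrE ?hilb_norm_ge0 ?ltW//.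
have midE : hilb_norm (2^-1%:C%C *: (a m + a n)) = 2^-1 * hilb_norm (a m + a n).
  by rewrite hilb_normZ_real// invr_ge0.
have : del <= hilb_norm (2^-1%:C%C *: (a m + a n)).
  by apply: ge_inf => //; exists (m, n).
rewrite midE => mid.
have := parallelogram (a m) (a n).
move: (aN _ Nm) (aN _ Nn) (hilb_norm_ge0 (a m)) (hilb_norm_ge0 (a n)).
nra.
Qed.

End hilbert.

(** * Egorov's theorem and a Borel-Cantelli diagonal choice *)

Section diagonal.
Context d (T : measurableType d) (R : realType).
Variable mu : {finite_measure set T -> \bar R}.

(** Egorov's theorem gives uniform convergence off a set of measure below [e]; one index far enough
    in the sequence is kept. *)
Lemma ae_cvg0_almost_uniform (f : nat -> T -> R) (e : R) :
  (forall k, measurable_fun setT (f k)) ->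
  {ae mu, forall w, f ^~ w @ \oo --> (0 : R)} -> 0 < e ->
  exists k B, [/\ measurable B, (mu B < e%:E)%E & forall w, ~ B w -> `|f k w| < e].
Proof.
move=> mf f0 e0.
have [|||||B [mB Be unifB]] :=
  @ae_pointwise_almost_uniform _ R T mu f (cst 0) setT e mf.
- exact: measurable_cst.
- exact: measurableT.
- exact: fin_num_fun_lty.
- by apply: ae_imp1 f0 => w fw _.
- by [].
have [|k _ /(_ k (leqnn k)) kB] := unifB
  [set h | forall w, (setT `\` B) w -> ball (0 : R) e (h w)].
  rewrite uniform_nbhs; exists [set xy | ball xy.1 e xy.2]; split => //.
  exact: entourage_ball (PosNum e0).
exists k, B; split => // w Bw.
have := kB w (conj I Bw); rewrite -ball_normE /= sub0r normrN; exact.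
Qed.

(** Take [k n] with [f n (k n)] below [2^-(n+1)] off a set [B n] of measure below [2^-(n+1)]. These
    measures are summable, so by Borel-Cantelli almost every point lies in only finitely many
    [B n]. *)
Lemma ae_diagonal_cvg0 (f : nat -> nat -> T -> R) :
  (forall n k, measurable_fun setT (f n k)) ->
  (forall n, {ae mu, forall w, f n ^~ w @ \oo --> (0 : R)}) ->
  exists k : nat -> nat, {ae mu, forall w, (fun n => f n (k n) w) @ \oo --> (0 : R)}.
Proof.
move=> mf f0.
have pos n : 0 < 1 / (2 ^ n.+1)%:R :> R by rewrite divr_gt0// ltr0n expn_gt0.
have /choice[k /choice[B kB]] n := ae_cvg0_almost_uniform (mf n) (f0 n) (pos n).
exists k.
have mB n : measurable (B n) by have [] := kB n.
have B0 : mu (lim_sup_set B) = 0%E.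
  apply: lim_sup_set_cvg0 => //.
  apply: le_lt_trans (ltry 1).
  apply: le_trans (epsilon_trick0 xpredT (ler01 : 0 <= 1 :> R)).
  by apply: lee_nneseries => // n _; apply/ltW; have [] := kB n.
have mlim : measurable (lim_sup_set B).
  by apply: bigcap_measurable => // n _; apply: bigcup_measurable.
exists (lim_sup_set B); split => // w /= nw.
apply: contrapT => Bw; apply: nw.
have [N hN] : exists N, forall n, (N <= n)%N -> ~ B n w.
  apply: contrapT => nN; apply: Bw => N _; apply: contrapT => nB.
  by apply: nN; exists N => n Nn Bn; apply: nB; exists n.
apply/norm_cvg0P.
apply: (@squeeze_cvgr _ _ _ _ (cst 0) (fun n => 2^-1 ^+ n)); first last.
- by apply: cvg_expr; rewrite ger0_norm// invf_lt1// ltr1n.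
- exact: cvg_cst.
exists N => // n /= Nn; rewrite normr_ge0/=.
have [_ _ /(_ w (hN n Nn))/ltW fkn] := kB n; apply: le_trans fkn _.
rewrite div1r natrX -exprVn exprS ger_pMl ?exprn_gt0 ?invr_gt0//.
by rewrite invf_le1// ler1n.
Qed.

End diagonal.

(** * Contractivity at almost every point, and order convergence *)

Section L0H_theory.
Context d (T : measurableType d) (R : realType).
Variables (mu : {measure set T -> \bar R}) (B : measurableBundle mu).
Hypothesis cmu : measure_is_complete mu.
Implicit Types x y : L0H B.

Lemma L0H_subE x y : {ae mu, forall w,
  L0H_val (x - y) w = L0H_val x w - L0H_val y w}.
Proof. by apply: ae_imp2 (L0H_addE x (- y)) (L0H_oppE y) => w -> ->. Qed.

Lemma L0H_cstE (a : R[i]) x : {ae mu, forall w,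
  L0H_val (L0_cst mu a *: x) w = a *: L0H_val x w}.
Proof. by apply: ae_imp2 (L0H_scaleE (L0_cst mu a) x) (L0_cstE mu a) => w -> ->. Qed.

Lemma measurable_L0H_norm x :
  measurable_fun setT (fun w => hilb_norm (L0H_val x w)).
Proof. exact: measurable_section_norm cmu _ (msectionP (repr x)). Qed.

Lemma L0_norm_leE x (a : L0 mu) (f : T -> R) :
  {ae mu, forall w, repr a w = (f w)%:C%C} ->
  L0_le (L0_norm cmu x) a <-> {ae mu, forall w, hilb_norm (L0H_val x w) <= f w}.
Proof.
move=> af; split=> h; apply: ae_imp3 h af (L0_normE cmu x) => w h aw nw.
  by move: h; rewrite nw aw hilb_normE lecR.
by rewrite nw aw hilb_normE lecR.
Qed.

Lemma L0_norm_le_norm x y : L0_le (L0_norm cmu x) (L0_norm cmu y) <->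
  {ae mu, forall w, hilb_norm (L0H_val x w) <= hilb_norm (L0H_val y w)}.
Proof.
apply: L0_norm_leE.
by apply: ae_imp1 (L0_normE cmu y) => w ->; exact: hilb_normE.
Qed.

Lemma L0_norm_le1 x : L0_le (L0_norm cmu x) 1 <->
  {ae mu, forall w, hilb_norm (L0H_val x w) <= 1}.
Proof. exact: L0_norm_leE (L0_1E mu). Qed.

(** The bound on the unit ball localises because [A] commutes with multiplication by elements of
    [L0], so [x] may be rescaled differently at each point. *)
Lemma L0_contraction_norm_le (A : {linear L0H B -> L0H B}) :
  L0_contraction cmu A -> forall x,
  {ae mu, forall w, hilb_norm (L0H_val (A x) w) <= hilb_norm (L0H_val x w)}.
Proof.
move=> [_ [s [sub _] s1]] x.
have h (n : nat) : {ae mu, forall w,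
    hilb_norm (L0H_val (A x) w) <= hilb_norm (L0H_val x w) + n.+1%:R^-1}.
  (* The summand [n.+1%:R^-1] keeps the denominator positive where [x] vanishes; it is removed at
     the end by letting [n] grow. *)
  pose f w := (hilb_norm (L0H_val x w) + n.+1%:R^-1)^-1.
  have pos w : 0 < hilb_norm (L0H_val x w) + n.+1%:R^-1.
    by rewrite ltr_wpDl ?hilb_norm_ge0// invr_gt0.
  have f0 w : 0 <= f w by rewrite invr_ge0 ltW.
  have mf : cmeasurable (fun w => (f w)%:C%C).
    split; last exact: measurable_cst.
    (* The absolute value leaves norms unchanged and makes the outer function continuous on the
       whole line. *)
    rewrite (_ : (fun w => _) = (fun r => (`|r| + n.+1%:R^-1)^-1) \o
        (fun w => hilb_norm (L0H_val x w))); last first.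
      by apply/funext => w /=; rewrite ger0_norm ?hilb_norm_ge0.
    apply: measurableT_comp; last exact: measurable_L0H_norm.
    apply: continuous_measurable_fun => r; apply: cvgV.
      by rewrite gt_eqF// ltr_wpDl// invr_gt0.
    by apply: cvgD; [exact: norm_continuous|exact: cvg_cst].
  pose a := L0_class mu mf.
  have aE : {ae mu, forall w, repr a w = (f w)%:C%C} by exact: L0_classE.
  have ax1 : L0_le (L0_norm cmu (a *: x)) 1.
    apply/L0_norm_le1; apply: ae_imp2 aE (L0H_scaleE a x) => w aw ->.
    rewrite aw hilb_normZ_real// mulrC -/(_ / _) ler_pdivrMr// mul1r.
    by rewrite lerDl invr_ge0.
  have /L0_norm_le1 Aax1 : L0_le (L0_norm cmu (A (a *: x))) 1.
    by apply: ae_imp2 (sub _ _) s1 => [w|]; [exact: le_trans|exists (a *: x)].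
  move: Aax1; rewrite linearZ /= => Aax1.
  apply: ae_imp3 aE (L0H_scaleE a (A x)) Aax1 => w aw ->.
  by rewrite aw hilb_normZ_real// mulrC -/(_ / _) ler_pdivrMr// mul1r.
apply: ae_imp1 (ae_foralln h) => w hw.
apply: (@cvgr_to_ge _ \oo _ _ (fun n => hilb_norm (L0H_val x w) + n.+1%:R^-1));
  last exact: nearW.
by rewrite -[X in _ --> X]addr0; apply: cvgD; [exact: cvg_cst|exact: cvg_harmonic].
Qed.

Lemma is_step_measurable_section s : is_step s -> is_measurable_section (B := B) s.
Proof.
move=> ss; exists (fun=> s); split => //.
by apply: aeW => w; rewrite subrr hilb_norm0; exact: cvg_cst.
Qed.

(** The suprema of the tails decrease and dominate the sequence; they provide the dominating
    sequence that order convergence asks for. *)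
Lemma cvg0_sup (u : nat -> R) : (forall n, 0 <= u n) -> u @ \oo --> (0 : R) ->
  let E n := fine (esups (EFin \o u) n) in
  [/\ forall n, E n.+1 <= E n, forall n, u n <= E n & E @ \oo --> (0 : R)].
Proof.
move=> u0 ucvg E.
(* A bound makes the suprema finite, so that [fine] never returns its default value. *)
have [M uM] : exists M, forall n, u n <= M.
  have [M [_ /(_ (M + 1))]] := cvg_seq_bounded (cvgP _ ucvg).
  rewrite ltrDl ltr01 => /(_ isT) hM; exists (M + 1) => n.
  by apply: le_trans (hM n I); rewrite ler_norm.
have uE n : ((u n)%:E <= esups (EFin \o u) n)%E.
  by apply: ereal_sup_ubound; exists n => /=.
have Efin n : esups (EFin \o u) n \is a fin_num.
  apply/fin_numP; split; apply/eqP => h.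
    by have := uE n; rewrite h.
  suff : (esups (EFin \o u) n <= M%:E)%E by rewrite h.
  by apply: ge_ereal_sup => _ [k _ <-]; rewrite lee_fin.
split.
- by move=> n; apply: fine_le => //; exact: nonincreasing_esups.
- by move=> n; rewrite -lee_fin fineK.
- have : esups (EFin \o u) @ \oo --> 0%:E.
    by apply: cvg_esups; apply: cvg_EFin; [exact: nearW|].
  by move=> /fine_cvgP[].
Qed.

(** The classes of the tail suprema of the norms dominate. A lower bound of all of them lies below a
    sequence tending to 0 at almost every point, hence below 0. *)
Lemma ae_cvg_bo_cvg (x : nat -> L0H B) l :
  {ae mu, forall w,
    (fun n => hilb_norm (L0H_val (x n) w - L0H_val l w)) @ \oo --> (0 : R)} ->
  bo_cvg cmu x l.
Proof.
move=> xl; pose g k w := hilb_norm (L0H_val (x k - l) w).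
have g0 k w : 0 <= g k w by exact: hilb_norm_ge0.
have gcvg : {ae mu, forall w, g ^~ w @ \oo --> (0 : R)}.
  apply: ae_imp2 xl (ae_foralln (fun n => L0H_subE (x n) l)) => w.
  by rewrite /g => xlw xlE; under eq_fun do rewrite xlE.
pose E n w := fine (esups (fun k => (g k w)%:E) n).
have mE n : cmeasurable (fun w => (E n w)%:C%C).
  split; last exact: measurable_cst.
  apply: (measurableT_comp (f := fine)); first exact: fine_measurable.
  apply: measurable_fun_esups => k; apply/measurable_EFinP.
  exact: measurable_L0H_norm.
pose e n := L0_class mu (mE n).
have eE n : {ae mu, forall w, repr (e n) w = (E n w)%:C%C} by exact: L0_classE.
have EE : {ae mu, forall w, [/\ forall n, E n.+1 w <= E n w,
    forall n, g n w <= E n w & E ^~ w @ \oo --> (0 : R)]}.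
  by apply: ae_imp1 gcvg => w gw; exact: cvg0_sup.
exists e; split.
- move=> n; apply: ae_imp3 (eE n) (eE n.+1) EE => w -> -> [+ _ _].
  by rewrite lecR.
- split=> [_ [n _ <-]|b be].
    apply: ae_imp3 (L0_0E mu) (eE n) EE => w -> -> [_ gE _].
    by rewrite lecR; exact: le_trans (g0 _ _) (gE n).
  have be' := ae_foralln (fun n => be _ (imageP e I) : L0_le b (e n)).
  have be'' : {ae mu, forall w n, repr b w <= (E n w)%:C%C}.
    by apply: ae_imp2 be' (ae_foralln eE) => w bw ew n; rewrite -ew; exact: bw.
  apply: ae_imp3 be'' EE (L0_0E mu) => w bw [_ _ Ecvg] ->.
  (* Comparability with a real number in [R[i]] forces [b] to be real at [w]. *)
  have b0 n : complex.Re (repr b w) <= E n w /\ complex.Im (repr b w) = 0.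
    by have := bw n; rewrite lecE /= => /andP[/eqP <-].
  rewrite lecE /= (b0 0%N).2 eqxx /=.
  by apply: (cvgr_to_ge Ecvg); apply: nearW => n /=; exact: (b0 n).1.
- move=> n; apply: (L0_norm_leE _ (eE n)).2.
  by apply: ae_imp1 EE => w [_ gE _]; exact: gE.
Qed.

End L0H_theory.

(** * Measurability of fibrewise limits *)

Section limit.
Context d (T : measurableType d) (R : realType).
Variables (mu : {finite_measure set T -> \bar R}) (B : measurableBundle mu).
Hypothesis cmu : measure_is_complete mu.

(** Each [a n] is a limit of step-sections [s n k]. The diagonal choice gives step-sections
    [s n (k n)] whose distance to [a n] tends to 0, so they converge to the limit of [a], which is
    therefore measurable. *)
Lemma ae_cvg_L0H (a : nat -> L0H B) :
  {ae mu, forall w, exists l : B w,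
    (fun n => hilb_norm (L0H_val (a n) w - l)) @ \oo --> (0 : R)} ->
  exists x : L0H B, {ae mu, forall w,
    (fun n => hilb_norm (L0H_val (a n) w - L0H_val x w)) @ \oo --> (0 : R)}.
Proof.
move=> al.
(* The default 0 is taken only where no limit exists, on a null set. *)
pose v w : B w := xget 0
  [set l | (fun n => hilb_norm (L0H_val (a n) w - l)) @ \oo --> (0 : R)].
have vP : {ae mu, forall w,
    (fun n => hilb_norm (L0H_val (a n) w - v w)) @ \oo --> (0 : R)}.
  by apply: ae_imp1 al => w [l lw]; rewrite /v; case: xgetP => [? -> //|/(_ l)].
have uae : {ae mu, forall w, (fun w => Some (v w) : option (B w)) w} by exact: aeW.
pose u : bsection mu B := BSection uae.
have /choice[s sP] n := msectionP (repr (a n)).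
pose f n k w := hilb_norm (sec_val (s n k) w - L0H_val (a n) w).
have mf n k : measurable_fun setT (f n k).
  have ms : is_measurable_section (s n k).
    by apply: is_step_measurable_section; exact: (sP n).1.
  (* [f n k] agrees almost everywhere with the norm of an element of [L0H]; completeness of the
     measure transfers measurability. *)
  apply: ae_eq_measurable cmu _ _ _ (measurable_L0H_norm cmu (L0H_class ms - a n)).
  apply: ae_imp2 (L0H_subE (L0H_class ms) (a n)) (L0H_classE ms) => w ->.
  by rewrite /f => ->.
have [k fk] := ae_diagonal_cvg0 mf (fun n => (sP n).2).
have um : is_measurable_section u.
  exists (fun n => s n (k n)); split => [n|]; first exact: (sP n).1.
  apply: ae_imp2 fk vP => w fw vw.
  apply: (@squeeze_cvgr _ _ _ _ (cst 0) (fun n =>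
    f n (k n) w + hilb_norm (L0H_val (a n) w - v w))).
  - apply: nearW => n; rewrite hilb_norm_ge0 /=.
    by rewrite -[X in hilb_norm X](subrKA (L0H_val (a n) w)); exact: hilb_normD.
  - exact: cvg_cst.
  - by rewrite -[X in _ --> X]addr0; exact: cvgD.
exists (L0H_class um); apply: ae_imp2 vP (L0H_classE um) => w vw ->.
exact: vw.
Qed.

End limit.

(** Squaring gives [0 <= |b|^2 + 2 n Re (i^k (a, b))]; large [n] forces the real part to be
    nonnegative, and the four powers of [i] then annihilate [(a, b)]. The scalars form a countable
    family, so the hypothesis can be verified off a single null set. *)
Lemma hilb_dot_eq0 (R : realType) (V : hilbertSpace R) (a b : V) :
  (forall n k : nat, hilb_norm ((n%:R * 'i%C ^+ k) *: a) <=
    hilb_norm ((n%:R * 'i%C ^+ k) *: a + b)) -> hilb_dot V a b = 0.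
Proof.
move=> ab.
have Re_ge0 k : 0 <= complex.Re ('i%C ^+ k * hilb_dot V a b).
  rewrite leNgt; apply/negP => r0.
  set r := complex.Re _ in r0.
  have [n nb] : exists n : nat, hilb_norm b ^+ 2 < n%:R * (- r).
    exists (Num.truncn (hilb_norm b ^+ 2 / - r)).+1.
    by rewrite -ltr_pdivrMr ?oppr_gt0// truncnS_gt.
  have := ab n k; rewrite -(ler_pXn2r (n := 2))// ?nnegrE ?hilb_norm_ge0//.
  rewrite hilb_norm_sqrD hilb_dotZl -mulrA.
  have -> : complex.Re (n%:R * ('i%C ^+ k * hilb_dot V a b)) = n%:R * r.
    rewrite -(rmorph_nat (real_complex R)) cReM /= mul0r subr0//.
  rewrite -addrA lerDl => h.
  have := sqr_ge0 (hilb_norm b); lra.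
have := (Re_ge0 0%N, Re_ge0 1%N, Re_ge0 2%N, Re_ge0 3%N).
case: (hilb_dot V a b) => x y; rewrite !exprS expr0 => -[[[h0 h1] h2] h3].
move: h0 h1 h2 h3; rewrite !cReM !cImM /= => h0 h1 h2 h3.
by congr (_ +i* _)%C; lra.
Qed.

(** * Calculus of almost everywhere convergence in [L0H] *)

Section ae_cvg.
Context d (T : measurableType d) (R : realType).
Variables (mu : {measure set T -> \bar R}) (B : measurableBundle mu).
Implicit Types (x y : L0H B) (s t : nat -> L0H B).

(** Limits are handled in this form throughout and turned into order convergence only at the end, by
    [ae_cvg_bo_cvg]. *)
Definition ae_cvg s x := {ae mu, forall w,
  (fun n => hilb_norm (L0H_val (s n) w - L0H_val x w)) @ \oo --> (0 : R)}.

Lemma ae_cvg_cst x : ae_cvg (fun=> x) x.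
Proof.
by apply: aeW => w; under eq_fun do rewrite subrr hilb_norm0; exact: cvg_cst.
Qed.

Lemma ae_cvg_unique s x y : ae_cvg s x -> ae_cvg s y -> x = y.
Proof.
move=> sx sy; apply/L0HP; apply: ae_imp2 sx sy => w sx sy.
apply/eqP; rewrite -subr_eq0 -hilb_norm_eq0 eq_le hilb_norm_ge0 andbT.
apply: (@cvgr_to_ge _ \oo _ _ (fun n => hilb_norm (L0H_val (s n) w - L0H_val x w) +
    hilb_norm (L0H_val (s n) w - L0H_val y w))).
  by rewrite -[X in _ --> X]addr0; exact: cvgD.
apply: nearW => n; rewrite (hilb_normB _ (L0H_val x w)).
by apply: le_trans (hilb_normD _ _); rewrite subrKA.
Qed.

Lemma ae_cvg_linear (c : L0 mu) s t x y : ae_cvg s x -> ae_cvg t y ->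
  ae_cvg (fun n => c *: s n + t n) (c *: x + y).
Proof.
have cE (z z' : L0H B) : {ae mu, forall w, L0H_val (c *: z + z') w =
    repr c w *: L0H_val z w + L0H_val z' w}.
  by apply: ae_imp2 (L0H_addE (c *: z) z') (L0H_scaleE c z) => w -> ->.
move=> sx ty.
have stE := ae_foralln (fun n => cE (s n) (t n)).
apply: filterS2 (filterI sx ty) (filterI (cE x y) stE) => w [{}sx {}ty] [xyE {}stE].
apply: (@squeeze_cvgr _ _ _ _ (cst 0) (fun n => complex.Re `|repr c w| *
    hilb_norm (L0H_val (s n) w - L0H_val x w) +
    hilb_norm (L0H_val (t n) w - L0H_val y w))).
- apply: nearW => n; rewrite hilb_norm_ge0/= xyE stE opprD addrACA -scalerBr.
  by rewrite -hilb_normZ; exact: hilb_normD.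
- exact: cvg_cst.
- rewrite -[X in _ --> X]addr0 -[X in _ --> X + _](mulr0 (complex.Re `|repr c w|)).
  by apply: cvgD => //; apply: cvgM => //; exact: cvg_cst.
Qed.

Lemma ae_cvg_norm_le s x (f : T -> R) : ae_cvg s x ->
  (forall n, {ae mu, forall w, hilb_norm (L0H_val (s n) w) <= f w}) ->
  {ae mu, forall w, hilb_norm (L0H_val x w) <= f w}.
Proof.
move=> sx sf; apply: ae_imp2 sx (ae_foralln sf) => w {}sx {}sf.
apply: (@cvgr_to_ge _ \oo _ _
  (fun n => hilb_norm (L0H_val (s n) w - L0H_val x w) + f w)).
  by rewrite -[X in _ --> X]add0r; apply: cvgD => //; exact: cvg_cst.
apply: nearW => n; rewrite hilb_normB.
apply: le_trans (lerD (lexx _) (sf n)).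
by apply: le_trans (hilb_normD _ _); rewrite subrK.
Qed.

End ae_cvg.

(** * Nonexpansive idempotents are projections *)

Section nonexpansive.
Context d (T : measurableType d) (R : realType).
Variables (mu : {measure set T -> \bar R}) (B : measurableBundle mu).
Implicit Types (x y : L0H B) (A : {linear L0H B -> L0H B}).

Definition nonexpansive A := forall x,
  {ae mu, forall w, hilb_norm (L0H_val (A x) w) <= hilb_norm (L0H_val x w)}.

Lemma nonexpansive_bounded (cmu : measure_is_complete mu) A :
  nonexpansive A -> L0_bounded_op cmu A.
Proof.
move=> nA S [a [b Sab]]; exists 0, b => _ [_ [x Sx <-] <-]; split.
  exact: L0_norm_ge0.
apply: ae_imp2 ((L0_norm_le_norm cmu _ _).2 (nA x)) (Sab _ (imageP _ Sx)).2 => w.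
exact: le_trans.
Qed.

(** [A] maps [c A x + (y - A y)] to [c A x], so nonexpansiveness and [hilb_dot_eq0] make the ranges
    of [A] and [1 - A] orthogonal. Hence [(A x, y) = (A x, A y) = (x, A y)]. *)
Lemma nonexpansive_idempotent_projection (cmu : measure_is_complete mu) A :
  nonexpansive A -> (forall x, A (A x) = A x) -> L0_projection cmu A.
Proof.
move=> nA AA; split => //; first exact: nonexpansive_bounded.
have orth x y : {ae mu, forall w,
    hilb_dot (B w) (L0H_val (A x) w) (L0H_val y w - L0H_val (A y) w) = 0}.
  have le n k : {ae mu, forall w,
     hilb_norm ((n%:R * 'i%C ^+ k) *: L0H_val (A x) w) <=
     hilb_norm ((n%:R * 'i%C ^+ k) *: L0H_val (A x) w +
                (L0H_val y w - L0H_val (A y) w))}.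
    set c : R[i] := _ * _.
    have := nA (L0_cst mu c *: A x + (y - A y)).
    rewrite linearD linearZ linearB /= !AA subrr addr0 => h.
    apply: filterS2 h (filterI (L0H_cstE c (A x))
      (filterI (L0H_addE (L0_cst mu c *: A x) (y - A y)) (L0H_subE y (A y)))).
    by move=> w h [xE [sE yE]]; rewrite sE xE yE in h.
  apply: ae_imp1 (ae_foralln (fun n => ae_foralln (le n))) => w.
  exact: hilb_dot_eq0.
have dotE x y : {ae mu, forall w, hilb_dot (B w) (L0H_val (A x) w) (L0H_val y w) =
    hilb_dot (B w) (L0H_val (A x) w) (L0H_val (A y) w)}.
  apply: ae_imp1 (orth x y) => w /eqP.
  by rewrite hilb_dotDr hilb_dotNr subr_eq0 => /eqP.
move=> x y; apply/L0P; near=> w.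
rewrite (near (L0_dotE cmu (A x) y) w)// (near (L0_dotE cmu x (A y)) w)//.
rewrite (near (dotE x y) w)// [RHS]hilb_dotC (near (dotE y x) w)//.
exact: hilb_dotC.
Unshelve. all: by end_near. Qed.

End nonexpansive.

(** * Ergodic sums, coboundaries and the midpoint estimate *)

Section ergodic_sums.
Context d (T : measurableType d) (R : realType).
Variables (mu : {measure set T -> \bar R}) (B : measurableBundle mu).
Variable A : {linear L0H B -> L0H B}.
Implicit Types u v y z : L0H B.

Definition ergodic_sum n u : L0H B := \sum_(0 <= k < n) iter k A u.

Lemma iter_linearP k (c : L0 mu) u v :
  iter k A (c *: u + v) = c *: iter k A u + iter k A v.
Proof. by elim: k => //= k ->; rewrite linearP. Qed.

Lemma ergodic_sum_linearP n (c : L0 mu) u v :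
  ergodic_sum n (c *: u + v) = c *: ergodic_sum n u + ergodic_sum n v.
Proof.
rewrite /ergodic_sum scaler_sumr -big_split /=.
by apply: eq_bigr => k _; exact: iter_linearP.
Qed.

Lemma ergodic_mean_linearP n (c : L0 mu) u v : ergodic_mean A n (c *: u + v) =
  c *: ergodic_mean A n u + ergodic_mean A n v.
Proof.
by rewrite /ergodic_mean [X in _ *: X]ergodic_sum_linearP scalerDr !scalerA mulrC.
Qed.

Lemma ergodic_sum_coboundary n v : ergodic_sum n (A v - v) = iter n A v - v.
Proof.
(* This shape lets [iter_linearP] apply; the sum then telescopes. *)
have -> : A v - v = (-1) *: v + A v by rewrite scaleN1r addrC.
elim: n => [|n ih]; first by rewrite /ergodic_sum big_nil /= subrr.
rewrite /ergodic_sum big_nat_recr //= -/(ergodic_sum n _) ih iter_linearP.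
by rewrite scaleN1r -iterSr /= [- _ + A _]addrC addrC addrA subrK addrC.
Qed.

Lemma natmul_L0_cst n u : u *+ n = L0_cst mu n%:R *: u.
Proof.
elim: n => [|n ih]; apply/L0HP.
  apply: ae_imp2 (L0H_0E B) (L0H_cstE 0 u) => w.
  by rewrite mulr0n => -> ->; rewrite scale0r.
rewrite mulrS ih; apply: ae_imp3 (L0H_addE u (L0_cst mu n%:R *: u))
  (L0H_cstE n%:R u) (L0H_cstE n.+1%:R u) => w -> -> ->.
by rewrite -natr1 scalerDl scale1r addrC.
Qed.

(** [L0] is not treated as a field, so the cancellation is checked in the fibres. *)
Lemma L0_cst_natK n u : L0_cst mu n.+1%:R^-1 *: (u *+ n.+1) = u.
Proof.
rewrite natmul_L0_cst; apply/L0HP.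
apply: ae_imp2 (L0H_cstE n.+1%:R^-1 (L0_cst mu n.+1%:R *: u))
  (L0H_cstE n.+1%:R u) => w -> ->.
by rewrite scalerA mulVf ?scale1r// pnatr_eq0.
Qed.

Lemma ergodic_mean_fixed n v : A v = v -> ergodic_mean A n.+1 v = v.
Proof.
move=> Av; rewrite /ergodic_mean (eq_bigr (fun=> v)); last first.
  by move=> k _; elim: k => //= k ->.
by rewrite sumr_const_nat subn0 L0_cst_natK.
Qed.

Hypothesis nA : nonexpansive A.

Lemma iter_norm_le k u : {ae mu, forall w,
  hilb_norm (L0H_val (iter k A u) w) <= hilb_norm (L0H_val u w)}.
Proof.
elim: k => [|k ih]; first exact: aeW.
by apply: ae_imp2 ih (nA (iter k A u)) => w /[swap]; exact: le_trans.
Qed.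

Lemma ergodic_sum_norm_le n u : {ae mu, forall w,
  hilb_norm (L0H_val (ergodic_sum n u) w) <= n%:R * hilb_norm (L0H_val u w)}.
Proof.
elim: n => [|n ih].
  rewrite /ergodic_sum big_nil; apply: ae_imp1 (L0H_0E B) => w ->.
  by rewrite hilb_norm0 mul0r.
rewrite /ergodic_sum big_nat_recr //= -/(ergodic_sum n u).
apply: ae_imp3 ih (iter_norm_le n u) (L0H_addE (ergodic_sum n u) (iter n A u)).
move=> w hS hi ->; apply: le_trans (hilb_normD _ _) _.
by rewrite -natr1 mulrDl mul1r lerD.
Qed.

(** [M] varies with the point but not with [n]; its values become the constants [C] of
    [midpoint_cvg]. *)
Definition bounded_ergodic_sums z := exists M : T -> R, forall n,
  {ae mu, forall w, hilb_norm (L0H_val (ergodic_sum n z) w) <= M w}.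

Lemma bounded_ergodic_sums_linear (c : L0 mu) y z :
  bounded_ergodic_sums y -> bounded_ergodic_sums z ->
  bounded_ergodic_sums (c *: y + z).
Proof.
move=> [M yM] [N zN].
exists (fun w => complex.Re `|repr c w| * M w + N w) => n.
rewrite ergodic_sum_linearP.
apply: filterS2 (filterI (yM n) (zN n)) (filterI
  (L0H_addE (c *: ergodic_sum n y) (ergodic_sum n z))
  (L0H_scaleE c (ergodic_sum n y))) => w [hy hz] [-> ->].
apply: le_trans (hilb_normD _ _) _; rewrite hilb_normZ lerD//.
by apply: ler_wpM2l => //; have := normr_ge0 (repr c w); rewrite lecE => /andP[].
Qed.

Lemma bounded_ergodic_sums0 : bounded_ergodic_sums 0.
Proof.
exists (fun=> 0) => n; have := ergodic_sum_norm_le n 0.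
by apply: ae_imp2 (L0H_0E B) => w -> ; rewrite hilb_norm0 mulr0.
Qed.

Lemma bounded_ergodic_sumsD y z : bounded_ergodic_sums y ->
  bounded_ergodic_sums z -> bounded_ergodic_sums (y + z).
Proof. by rewrite -{2}[y]scale1r; exact: bounded_ergodic_sums_linear. Qed.

Lemma bounded_ergodic_sumsZ (c : L0 mu) y : bounded_ergodic_sums y ->
  bounded_ergodic_sums (c *: y).
Proof.
rewrite -[c *: y]addr0 => hy.
exact: bounded_ergodic_sums_linear hy bounded_ergodic_sums0.
Qed.

Lemma bounded_ergodic_sums_coboundary v : bounded_ergodic_sums (v - A v).
Proof.
rewrite -opprB -scaleN1r; apply: bounded_ergodic_sumsZ.
exists (fun w => hilb_norm (L0H_val v w) *+ 2) => n.
rewrite ergodic_sum_coboundary.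
apply: ae_imp2 (iter_norm_le n v) (L0H_subE (iter n A v) v) => w h ->.
by apply: le_trans (hilb_normD _ _) _; rewrite hilb_normN mulr2n lerD2r.
Qed.

(** The difference is the sum of the coboundaries of [iter j A u] for [j < k]. *)
Lemma bounded_ergodic_sums_iter k u : bounded_ergodic_sums (u - iter k A u).
Proof.
elim: k => [|k ih] /=; first by rewrite subrr; exact: bounded_ergodic_sums0.
rewrite -(subrKA (iter k A u)); apply: bounded_ergodic_sumsD => //.
exact: bounded_ergodic_sums_coboundary.
Qed.

(** Writing [u] as the mean of [p.+1] copies of itself makes the difference a mean of terms
    [u - iter k A u]. *)
Lemma bounded_ergodic_sums_mean p u :
  bounded_ergodic_sums (u - ergodic_mean A p.+1 u).
Proof.
rewrite -{1}(L0_cst_natK p u) /ergodic_mean -scalerBr.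
apply: bounded_ergodic_sumsZ.
have -> : u *+ p.+1 = \sum_(0 <= k < p.+1) u by rewrite sumr_const_nat subn0.
rewrite -sumrB.
elim/big_ind : _ => //; first exact: bounded_ergodic_sums0.
  exact: bounded_ergodic_sumsD.
by move=> k _; exact: bounded_ergodic_sums_iter.
Qed.

Lemma ergodic_mean_cvg0 z : bounded_ergodic_sums z ->
  ae_cvg (fun n => ergodic_mean A n.+1 z) 0.
Proof.
move=> [M zM].
have mE := ae_foralln (fun n => L0H_cstE n.+1%:R^-1 (ergodic_sum n.+1 z)).
apply: ae_imp3 (ae_foralln zM) mE (L0H_0E B) => w zw mw ->.
apply: (@squeeze_cvgr _ _ _ _ (cst 0) (fun n => n.+1%:R^-1 * M w)).
- apply: nearW => n; rewrite hilb_norm_ge0 /= subr0 mw.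
  rewrite -(rmorph_nat (real_complex R)) -fmorphV hilb_normZ_real ?invr_ge0//.
  by rewrite ler_wpM2l ?invr_ge0.
- exact: cvg_cst.
- rewrite -[X in _ --> X](mul0r (M w)).
  by apply: cvgM; [exact: cvg_harmonic|exact: cvg_cst].
Qed.

Lemma ergodic_mean_norm_le n u : {ae mu, forall w,
  hilb_norm (L0H_val (ergodic_mean A n.+1 u) w) <= hilb_norm (L0H_val u w)}.
Proof.
apply: ae_imp2 (L0H_cstE n.+1%:R^-1 (ergodic_sum n.+1 u))
  (ergodic_sum_norm_le n.+1 u) => w -> h.
rewrite -(rmorph_nat (real_complex R)) -fmorphV hilb_normZ_real ?invr_ge0//.
by rewrite ler_pdivrMl.
Qed.

(** This supplies the hypothesis of [midpoint_cvg] at almost every point: split [u] as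
    [y + (u - y)], where the means of [y] are no longer than [y] and the sums of [u - y] are
    bounded. *)
Lemma ergodic_mean_midpoint p q u : exists M : T -> R, forall n, {ae mu, forall w,
  hilb_norm (L0H_val (ergodic_mean A n.+1 u) w) <=
  hilb_norm (2^-1%:C%C *: (L0H_val (ergodic_mean A p.+1 u) w +
                           L0H_val (ergodic_mean A q.+1 u) w)) + M w / n.+1%:R}.
Proof.
set mp := ergodic_mean A p.+1 u; set mq := ergodic_mean A q.+1 u.
pose y := L0_cst mu 2%:R^-1 *: (mp + mq).
have [M zM] : bounded_ergodic_sums (u - y).
  (* With [u] as half of [u + u], the difference [u - y] is half of [(u - mp) + (u - mq)]. *)
  rewrite -{1}(L0_cst_natK 1 u) -scalerBr mulr2n opprD addrACA.
  apply: bounded_ergodic_sumsZ.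
  by apply: bounded_ergodic_sumsD; exact: bounded_ergodic_sums_mean.
exists M => n.
have uE : u = 1 *: y + (u - y) by rewrite scale1r addrC subrK.
rewrite [X in ergodic_mean A n.+1 X]uE ergodic_mean_linearP scale1r.
have half : 2%:R^-1 = (2^-1)%:C%C :> R[i] by rewrite fmorphV rmorph_nat.
apply: filterS2
  (filterI (zM n.+1) (filterI (ergodic_mean_norm_le n y)
    (L0H_cstE n.+1%:R^-1 (ergodic_sum n.+1 (u - y)))))
  (filterI (L0H_addE (ergodic_mean A n.+1 y) (ergodic_mean A n.+1 (u - y)))
  (filterI (L0H_cstE 2%:R^-1 (mp + mq)) (L0H_addE mp mq))).
move=> w [zw [yw mw]] [-> [yE sE]]; apply: le_trans (hilb_normD _ _) _.
apply: lerD; first by rewrite -half -sE -yE.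
rewrite mw -(rmorph_nat (real_complex R)) -fmorphV hilb_normZ_real ?invr_ge0//.
by rewrite mulrC ler_wpM2r ?invr_ge0.
Qed.

End ergodic_sums.

(** * Convergence of the means and the limit projection *)

Section mean_ergodic.
Context d (T : measurableType d) (R : realType).
Variables (mu : {finite_measure set T -> \bar R}) (B : measurableBundle mu).
Hypothesis cmu : measure_is_complete mu.
Variable A : {linear L0H B -> L0H B}.
Hypothesis nA : nonexpansive A.

Lemma ergodic_mean_ae_cvg u : exists v, ae_cvg (fun n => ergodic_mean A n.+1 u) v.
Proof.
apply: ae_cvg_L0H => //.
have /choice[M MP] (pq : nat * nat) := ergodic_mean_midpoint nA pq.1 pq.2 u.
(* The indices [p], [q], [n] are countably many, so one null set serves all the estimates. *)
apply: ae_imp1 (ae_foralln (fun p => ae_foralln (fun q => ae_foralln (MP (p, q))))).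
by move=> w h; apply: midpoint_cvg => p q; exists (M (p, q) w) => n; exact: h.
Qed.

(** The images under [A] of the means tend to [A v] by nonexpansiveness. They also tend to [v],
    since they differ from the means by the means of the coboundary [u - A u], which tend to 0. *)
Lemma ergodic_limit_fixed u v :
  ae_cvg (fun n => ergodic_mean A n.+1 u) v -> A v = v.
Proof.
move=> uv; apply: (ae_cvg_unique (s := fun n => A (ergodic_mean A n.+1 u))).
  apply: filterS2 uv (filterI
    (ae_foralln (fun n => nA (ergodic_mean A n.+1 u - v)))
    (filterI (ae_foralln (fun n => L0H_subE (ergodic_mean A n.+1 u) v))
    (ae_foralln (fun n => L0H_subE (A (ergodic_mean A n.+1 u)) (A v))))).
  move=> w uvw [Aw [sE AsE]].
  apply: squeeze_cvgr uvw; last exact: cvg_cst.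
  apply: nearW => n; rewrite hilb_norm_ge0 /= -AsE -sE -linearB.
  exact: Aw.
have := ae_cvg_linear (-1)
  (ergodic_mean_cvg0 (bounded_ergodic_sums_coboundary nA u)) uv.
rewrite scaler0 add0r.
suff -> : (fun n => -1 *: ergodic_mean A n.+1 (u - A u) + ergodic_mean A n.+1 u) =
  (fun n => A (ergodic_mean A n.+1 u)) by [].
apply/funext => n; rewrite -ergodic_mean_linearP scaleN1r opprB subrK.
rewrite /ergodic_mean linearZ /=; congr (_ *: _).
rewrite [RHS]linear_sum; apply: eq_bigr => k _; exact: (esym (iterSr _ _ _)).
Qed.

End mean_ergodic.

Theorem theorem3p3 (d : measure_display) (Omega : measurableType d)
    (R : realType) (mu : {finite_measure set Omega -> \bar R})
    (mu_complete : measure_is_complete mu) (H : measurableBundle mu)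
    (T : {linear L0H H -> L0H H}) (T_contraction : L0_contraction mu_complete T) :
  exists P : {linear L0H H -> L0H H}, L0_projection mu_complete P /\
    forall u : L0H H,
      bo_cvg mu_complete (fun n => ergodic_mean T n.+1 u) (P u).
Proof.
have nT : nonexpansive T := L0_contraction_norm_le T_contraction.
have /choice[f fP] := ergodic_mean_ae_cvg mu_complete nT.
(* The limits were chosen separately for each [u]; their almost everywhere uniqueness makes the
   choice linear. *)
have f_lin : linear f.
  move=> c u v; apply: ae_cvg_unique (fP (c *: u + v)) _.
  have := ae_cvg_linear c (fP u) (fP v).
  by under eq_fun do rewrite -ergodic_mean_linearP.
pose P : {linear L0H H -> L0H H} :=
  HB.pack f (GRing.isLinear.Build _ _ _ _ f f_lin).
exists P; split; last by move=> u; exact/ae_cvg_bo_cvg/fP.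
apply: nonexpansive_idempotent_projection => [u|u].
  by apply: ae_cvg_norm_le (fP u) _ => n; exact: ergodic_mean_norm_le.
(* Idempotence: all means of the fixed vector [f u] equal [f u], and so does their limit
   [f (f u)]. *)
have Tf : T (f u) = f u := ergodic_limit_fixed nT (fP u).
apply: ae_cvg_unique (fP (f u)) _.
by under eq_fun do rewrite ergodic_mean_fixed//; exact: ae_cvg_cst.
Qed.
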